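(* Let $G$ be a (discrete, finitely generated) hyperbolic group with asymptotic dimension $\operatorname{asdim}G\le 2$. Then every finitely presented subgroup of $G$ is hyperbolic.
   Context: $\operatorname{asdim}G$ denotes the asymptotic dimension of $G$ with a word metric with respect to a finite generating set (a quasi-isometry invariant). *)

(* Defs.v *)
From Stdlib Require Import List ZArith Lia.
Import ListNotations.
Set Implicit Arguments.

Record Group := {
  gcar :> Type;
  gmul : gcar -> gcar -> gcar;
  ginv : gcar -> gcar;
  gone : gcar;
  gassoc : forall x y z, gmul x (gmul y z) = gmul (gmul x y) z;
  gone_mul : forall x, gmul gone x = x;
  ginv_mul : forall x, gmul (ginv x) x = gone
}.

Section Words.
Variable G : Group.

(** A letter (true, s) stands for s, (false, s) for s^-1. *)
Definition letter := (bool * gcar G)%type.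
Definition word := list letter.

Definition eval_letter (a : letter) : gcar G :=
  if fst a then snd a else ginv G (snd a).

Fixpoint eval (w : word) : gcar G :=
  match w with
  | [] => gone G
  | a :: w' => gmul G (eval_letter a) (eval w')
  end.

Definition inv_letter (a : letter) : letter := (negb (fst a), snd a).
Definition winv (w : word) : word := rev (map inv_letter w).

Definition word_over (S : list (gcar G)) (w : word) : Prop :=
  forall a, In a w -> In (snd a) S.

Definition is_subgroup (H : gcar G -> Prop) : Prop :=
  H (gone G) /\ (forall x y, H x -> H y -> H (gmul G x y)) /\
  (forall x, H x -> H (ginv G x)).

Definition generates (H : gcar G -> Prop) (S : list (gcar G)) : Prop :=
  (forall s, In s S -> H s) /\
  (forall h, H h -> exists w, word_over S w /\ eval w = h).

Definition is_dist (S : list (gcar G)) (x y : gcar G) (d : nat) : Prop :=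
  (exists w, word_over S w /\ length w = d /\ eval w = gmul G (ginv G x) y) /\
  (forall w, word_over S w -> eval w = gmul G (ginv G x) y -> d <= length w).

(** Gromov hyperbolicity of the word metric on H (four-point condition with
    Gromov products, multiplied by 2 to stay in Z):
    (x|y)_w >= min((x|z)_w, (y|z)_w) - delta. *)
Definition four_point (H : gcar G -> Prop) (S : list (gcar G)) (delta : nat) : Prop :=
  forall x y z w, H x -> H y -> H z -> H w ->
  forall dxy dxz dyz dxw dyw dzw,
    is_dist S x y dxy -> is_dist S x z dxz -> is_dist S y z dyz ->
    is_dist S x w dxw -> is_dist S y w dyw -> is_dist S z w dzw ->
    (Z.of_nat dxw + Z.of_nat dyw - Z.of_nat dxy >=
     Z.min (Z.of_nat dxw + Z.of_nat dzw - Z.of_nat dxz)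
           (Z.of_nat dyw + Z.of_nat dzw - Z.of_nat dyz) - 2 * Z.of_nat delta)%Z.

Definition hyperbolic (H : gcar G -> Prop) : Prop :=
  exists S, generates H S /\ exists delta : nat, four_point H S delta.

Definition full : gcar G -> Prop := fun _ => True.

Definition asdim_le (n : nat) : Prop :=
  exists S, generates full S /\
  forall r : nat, exists D : nat,
  exists (I : Type) (col : I -> nat) (U : I -> gcar G -> Prop),
    (forall x, exists i, U i x) /\
    (forall i, col i <= n) /\
    (forall i x y d, U i x -> U i y -> is_dist S x y d -> d <= D) /\
    (forall i j, i <> j -> col i = col j ->
       forall x y d, U i x -> U j y -> is_dist S x y d -> r < d).

Inductive free_step : word -> word -> Prop :=
| FreeStep : forall u v a, free_step (u ++ a :: inv_letter a :: v) (u ++ v).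

(** Words representing elements of the normal closure of the relators Rel
    in the free group on the letters. *)
Inductive in_ncl (Rel : list word) : word -> Prop :=
| ncl_nil : in_ncl Rel []
| ncl_conj : forall u r, In r Rel -> in_ncl Rel (u ++ r ++ winv u)
| ncl_conj_inv : forall u r, In r Rel -> in_ncl Rel (u ++ winv r ++ winv u)
| ncl_app : forall w1 w2, in_ncl Rel w1 -> in_ncl Rel w2 -> in_ncl Rel (w1 ++ w2)
| ncl_red : forall w w', in_ncl Rel w -> free_step w w' -> in_ncl Rel w'
| ncl_unred : forall w w', in_ncl Rel w' -> free_step w w' -> in_ncl Rel w.

Definition fin_presented (H : gcar G -> Prop) : Prop :=
  exists S (Rel : list word), generates H S /\
    (forall r, In r Rel -> word_over S r /\ eval r = gone G) /\
    (forall w, word_over S w -> eval w = gone G -> in_ncl Rel w).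

End Words.

(* Main.v *)
Require Import Defs.
From Stdlib Require Import List ZArith Lia.
From Stdlib Require Import Bool Permutation Wf_nat.
From Stdlib Require Import Classical ClassicalEpsilon ProofIrrelevance.
Import ListNotations.
Set Implicit Arguments.

(** All chains are mod 2 simplicial chains of Rips complexes. A loop of length
    [n] in the subgroup [H] has a filling [c_H], of uncontrolled size, by
    relators of [H], and a filling [c_G] of size [O(n)] in the hyperbolic group
    [G]. Their sum is a 2-cycle, hence a boundary in a Rips complex of [G] at
    some fixed scale. A cover of [G] witnessing [asdim G <= 2] at this scale
    yields a map [phi] to a set of indices under which every 3-simplex
    degenerates; so [phi c_H = phi c_G], and this chain has size [O(n)].
    Choosing points of [H] in the sets of the cover that meet [H] maps
    [phi c_H] back to [H], and the composite moves points of [H] by a bounded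
    amount. Thus loops of [H] have linear fillings.

    Linear fillings imply hyperbolicity: in a minimal filling of a loop made of
    a geodesic and a path, the area of the ball of radius [k] around a point of
    the geodesic grows exponentially in [k] until the ball reaches the path.
    So geodesics stay logarithmically close to paths with the same endpoints,
    which makes triangles slim. *)

(** * Mod 2 sums over lists *)

(** The obstacle is that [c_G] leaves the subgroup while the size of [c_H] is uncontrolled.
    Homologous chains may differ greatly in size, and dimension two turns homology into equality:
    sets of one colour are far apart, so of the four vertices of a 3-simplex, with only three
    colours available, two lie in the same set. After cancellation the common image has at most as
    many triangles as [c_G], yet each of them is the image of a triangle of [c_H]; its vertices
    therefore index sets that meet the subgroup and can be pulled back there. The metrics of the
    subgroup and of the group are compared only through the finiteness of balls, so that arbitrary
    distortion is harmless.

    Chains are lists, and identities between them are tested by evaluating symmetric cochains. In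
    particular no 3-chain is ever built: that a cycle bounds is used in the dual form that every
    cocycle vanishes on it. *)

Definition dec (P : Prop) : bool :=
  if excluded_middle_informative P then true else false.

Lemma dec_elim (P : Prop) : dec P = true -> P.
Proof. unfold dec. destruct (excluded_middle_informative P); congruence || tauto. Qed.
Lemma dec_intro (P : Prop) : P -> dec P = true.
Proof. unfold dec. destruct (excluded_middle_informative P); congruence || tauto. Qed.
Lemma dec_elim_not (P : Prop) : dec P = false -> ~ P.
Proof. unfold dec. destruct (excluded_middle_informative P); congruence || tauto. Qed.
Lemma dec_intro_not (P : Prop) : ~ P -> dec P = false.
Proof. unfold dec. destruct (excluded_middle_informative P); congruence || tauto. Qed.

Lemma least_nat (P : nat -> Prop) :
  (exists n, P n) -> exists n, P n /\ forall m, P m -> n <= m.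
Proof.
  intros [n Hn]. induction n as [n IH] using lt_wf_ind.
  destruct (classic (exists m, m < n /\ P m)) as [[m [Hm Pm]] | Hno].
  - exact (IH m Hm Pm).
  - exists n. split; [exact Hn|]. intros m Pm.
    destruct (le_lt_dec n m); auto. exfalso; eauto.
Qed.

Fixpoint xsum {A : Type} (f : A -> bool) (l : list A) : bool :=
  match l with
  | [] => false
  | a :: l' => xorb (f a) (xsum f l')
  end.

Section Xsum.
Variables A B : Type.

Lemma xsum_app (f : A -> bool) l m : xsum f (l ++ m) = xorb (xsum f l) (xsum f m).
Proof.
  induction l; simpl; [now destruct (xsum f m)|].
  now rewrite IHl, xorb_assoc.
Qed.

Lemma xsum_map (f : B -> bool) (h : A -> B) l :
  xsum f (map h l) = xsum (fun a => f (h a)) l.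
Proof. induction l; simpl; congruence. Qed.

Lemma xsum_ext (f g : A -> bool) l :
  (forall a, In a l -> f a = g a) -> xsum f l = xsum g l.
Proof.
  induction l; simpl; intros H; [reflexivity|].
  now rewrite (H a), IHl by auto.
Qed.

Lemma xsum_xorb (f g : A -> bool) l :
  xsum (fun a => xorb (f a) (g a)) l = xorb (xsum f l) (xsum g l).
Proof.
  induction l; simpl; [reflexivity|]. rewrite IHl.
  destruct (f a), (g a), (xsum f l), (xsum g l); reflexivity.
Qed.

Lemma xsum_zero (f : A -> bool) l : (forall a, In a l -> f a = false) -> xsum f l = false.
Proof.
  induction l; simpl; intros H; [reflexivity|].
  now rewrite (H a), IHl by auto.
Qed.

Lemma xsum_true (f : A -> bool) l : xsum f l = true -> exists a, In a l /\ f a = true.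
Proof.
  intros H. apply NNPP. intros Hn. rewrite xsum_zero in H; [discriminate|].
  intros a Ha. destruct (f a) eqn:E; auto. exfalso; eauto.
Qed.

Lemma xsum_filter (f p : A -> bool) l :
  xsum f l = xorb (xsum f (filter p l)) (xsum f (filter (fun a => negb (p a)) l)).
Proof.
  induction l; simpl; [reflexivity|]. rewrite IHl.
  destruct (p a); simpl; destruct (f a), (xsum f (filter p l)),
    (xsum f (filter (fun a => negb (p a)) l)); reflexivity.
Qed.

Lemma filter_length_diff (p q : A -> bool) l :
  (forall a, p a = true -> q a = true) ->
  length (filter q l) =
    length (filter p l) + length (filter (fun a => q a && negb (p a)) l).
Proof.
  intros H. induction l as [|a l IH]; simpl; [reflexivity|].
  destruct (p a) eqn:Ep; [rewrite (H a Ep)|]; simpl; [lia|].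
  destruct (q a); simpl; lia.
Qed.

End Xsum.

(** * Reduced mod 2 chains *)

Section Reduce.
Variables (A : Type) (E : A -> A -> Prop) (deg : A -> Prop).
Hypothesis E_refl : forall a, E a a.
Hypothesis E_sym : forall a b, E a b -> E b a.
Hypothesis E_trans : forall a b c, E a b -> E b c -> E a c.
Hypothesis deg_E : forall a b, E a b -> deg a -> deg b.

(** Lists represent mod 2 chains on the classes of [E], with [deg] entries equal to zero. Admissible
    functions are the functionals on this quotient; two lists are the same chain when all of them
    agree. *)
Definition admissible (f : A -> bool) : Prop :=
  (forall a b, E a b -> f a = f b) /\ (forall a, deg a -> f a = false).

Definition reduced (l : list A) : Prop :=
  Forall (fun a => ~ deg a) l /\ ForallOrdPairs (fun a b => ~ E a b) l.

Lemma reduced_remove l1 b l2 : reduced (l1 ++ b :: l2) -> reduced (l1 ++ l2).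
Proof.
  intros [H1 H2]. split.
  - apply Forall_app in H1 as [H1 H1']. inversion H1'. apply Forall_app; auto.
  - clear H1. induction l1 as [|a l1 IH]; simpl in *.
    + now inversion H2.
    + inversion H2 as [|? ? H3 H4]; subst. constructor; [|auto].
      apply Forall_app in H3 as [H3 H3']. inversion H3'. apply Forall_app; auto.
Qed.

Lemma reduced_representative (l : list A) :
  exists l', incl l' l /\ reduced l' /\
    forall f, admissible f -> xsum f l' = xsum f l.
Proof.
  induction l as [|a l (l' & Hi & Hr & Hf)].
  - exists []. split; [apply incl_refl|]. split; [split; constructor|]. reflexivity.
  - destruct (classic (deg a)) as [Hd|Hd].
    { exists l'. split; [now apply incl_tl|]. split; [exact Hr|].
      intros f Af. simpl. rewrite (proj2 Af a Hd), (Hf f Af). now destruct (xsum f l). }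
    destruct (classic (exists b, In b l' /\ E a b)) as [[b [Hb Eab]]|Hn].
    + apply in_split in Hb as (l1 & l2 & ->).
      exists (l1 ++ l2). split; [|split; [eapply reduced_remove; eauto|]].
      * intros x Hx. right. apply Hi. apply in_app_iff in Hx. apply in_app_iff. simpl. tauto.
      * intros f Af. simpl. rewrite <- (Hf f Af), !xsum_app. simpl.
        rewrite (proj1 Af a b Eab).
        destruct (f b), (xsum f l1), (xsum f l2); reflexivity.
    + exists (a :: l'). split; [|split].
      * intros x [->|Hx]; [now left|right; auto].
      * destruct Hr. split; constructor; auto.
        apply Forall_forall. intros b Hb Eab. eauto.
      * intros f Af. simpl. now rewrite Hf.
Qed.

Lemma reduced_length (l m : list A) :
  reduced l -> (forall t, In t l -> exists u, In u m /\ E t u) -> length l <= length m.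
Proof.
  revert m. induction l as [|t l IH]; intros m Hr H; simpl; [lia|].
  destruct (H t (or_introl eq_refl)) as (u & Hu & Etu).
  apply in_split in Hu as (m1 & m2 & ->).
  assert (length l <= length (m1 ++ m2)).
  { apply IH.
    - destruct Hr as [H1 H2]. inversion H1; inversion H2; split; auto.
    - intros t' Ht'. destruct (H t' (or_intror Ht')) as (u' & Hu' & Etu').
      exists u'. split; [|exact Etu'].
      apply in_app_iff in Hu'. apply in_app_iff. destruct Hu' as [|[<-|]]; auto.
      exfalso. destruct Hr as [_ H2]. inversion H2 as [|? ? H3]; subst.
      rewrite Forall_forall in H3. apply (H3 t' Ht'). eauto. }
  rewrite length_app in *. simpl. lia.
Qed.

Definition class_of (t u : A) : bool := dec (E t u).

Lemma class_of_admissible t : ~ deg t -> admissible (class_of t).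
Proof.
  intros Hd. unfold class_of. split.
  - intros a b Eab. destruct (dec (E t b)) eqn:H.
    + apply dec_elim in H. apply dec_intro. exact (E_trans H (E_sym Eab)).
    + apply dec_elim_not in H. apply dec_intro_not. intros H'. exact (H (E_trans H' Eab)).
  - intros a Ha. apply dec_intro_not. intros H. apply Hd. exact (deg_E (E_sym H) Ha).
Qed.

Lemma xsum_class_of l t : reduced l -> In t l -> xsum (class_of t) l = true.
Proof.
  intros [_ Hr]. induction l as [|a l IH]; simpl; [tauto|].
  inversion Hr as [|? ? H1 H2]; subst. rewrite Forall_forall in H1.
  intros [->|Ht].
  - rewrite xsum_zero.
    + unfold class_of. rewrite dec_intro; [reflexivity|auto].
    + intros b Hb. apply dec_intro_not. auto.
  - rewrite IH by auto. unfold class_of. rewrite dec_intro_not; [reflexivity|].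
    intros H. apply (H1 t Ht). auto.
Qed.

(** Testing against the indicator of the class of [t] shows that this class occurs in every list of
    the same chain. With [reduced_length], a reduced list is a shortest representative. *)
Lemma reduced_in (l m : list A) t :
  reduced l -> In t l -> (forall f, admissible f -> xsum f l = xsum f m) ->
  exists u, In u m /\ E t u.
Proof.
  intros Hr Ht H.
  assert (Hd : ~ deg t) by (destruct Hr as [H1 _]; rewrite Forall_forall in H1; auto).
  assert (Hx := xsum_class_of t Hr Ht).
  rewrite (H _ (class_of_admissible Hd)) in Hx.
  apply xsum_true in Hx as (u & Hu & Eu). apply dec_elim in Eu. eauto.
Qed.

End Reduce.

(** * Edges, triangles and boundaries *)

Section Simplices.
Variable X : Type.

Definition same_edge (e f : X * X) : Prop :=
  (fst e = fst f /\ snd e = snd f) \/ (fst e = snd f /\ snd e = fst f).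
Definition degenerate_edge (e : X * X) : Prop := fst e = snd e.

Definition vertices (t : X * X * X) : list X :=
  match t with (a, b, c) => [a; b; c] end.
Definition same_triangle (t u : X * X * X) : Prop := Permutation (vertices t) (vertices u).
Definition degenerate_triangle (t : X * X * X) : Prop := ~ NoDup (vertices t).

Definition cochain1 (g : X * X -> bool) : Prop :=
  (forall a b, g (a, b) = g (b, a)) /\ (forall a, g (a, a) = false).
(** The two transpositions generate all permutations of the vertices, so vanishing on [(a, a, b)]
    covers every degenerate triangle. *)
Definition cochain2 (f : X * X * X -> bool) : Prop :=
  (forall a b c, f (a, b, c) = f (b, a, c)) /\
  (forall a b c, f (a, b, c) = f (a, c, b)) /\ (forall a b, f (a, a, b) = false).

Lemma cochain1_admissible g :
  cochain1 g -> admissible same_edge degenerate_edge g.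
Proof.
  intros [H1 H2]. split.
  - intros [a b] [a' b'] [[? ?]|[? ?]]; simpl in *; subst; auto.
  - intros [a b] Hd. unfold degenerate_edge in Hd. simpl in Hd. now subst.
Qed.

Lemma admissible_cochain1 g :
  admissible same_edge degenerate_edge g -> cochain1 g.
Proof.
  intros [H1 H2]. split.
  - intros a b. apply H1. right; auto.
  - intros a. apply H2. reflexivity.
Qed.

Lemma cochain2_admissible f :
  cochain2 f -> admissible same_triangle degenerate_triangle f.
Proof.
  intros (H1 & H2 & H3). split.
  - intros [[a b] c] [[a' b'] c'] HP. unfold same_triangle in HP. simpl in HP.
    assert (Ha : In a [a'; b'; c']) by (eapply Permutation_in; [exact HP|now left]).
    destruct Ha as [->|[->|[->|[]]]].
    + apply Permutation_cons_inv in HP. apply Permutation_length_2_inv in HP.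
      destruct HP as [HP|HP]; injection HP as -> ->; auto.
    + rewrite (perm_swap a a' [c']) in HP.
      apply Permutation_cons_inv in HP. apply Permutation_length_2_inv in HP.
      destruct HP as [HP|HP]; injection HP as -> ->; rewrite H1; auto.
      now rewrite H1, H2.
    + rewrite (perm_skip a' (perm_swap a b' [])), (perm_swap a a' [b']) in HP.
      apply Permutation_cons_inv in HP. apply Permutation_length_2_inv in HP.
      destruct HP as [HP|HP]; injection HP as -> ->.
      * now rewrite H1, H2.
      * now rewrite H2, H1, H2.
  - intros [[a b] c] Hd. unfold degenerate_triangle in Hd. simpl in Hd.
    destruct (classic (a = b)) as [->|n1]; [apply H3|].
    destruct (classic (b = c)) as [->|n2]; [rewrite H1, H2; apply H3|].
    destruct (classic (a = c)) as [->|n3]; [rewrite H2; apply H3|].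
    exfalso. apply Hd. repeat constructor; simpl; intuition congruence.
Qed.

Lemma admissible_cochain2 f :
  admissible same_triangle degenerate_triangle f -> cochain2 f.
Proof.
  intros [H1 H2]. repeat split.
  - intros a b c. apply H1. apply perm_swap.
  - intros a b c. apply H1. apply perm_skip, perm_swap.
  - intros a b. apply H2. intros H. inversion H. simpl in *. tauto.
Qed.

Lemma same_edge_refl e : same_edge e e.
Proof. left; auto. Qed.
Lemma same_edge_sym e f : same_edge e f -> same_edge f e.
Proof. unfold same_edge. intuition congruence. Qed.
Lemma same_edge_trans e f g : same_edge e f -> same_edge f g -> same_edge e g.
Proof. unfold same_edge. intuition congruence. Qed.
Lemma same_edge_degenerate e f : same_edge e f -> degenerate_edge e -> degenerate_edge f.
Proof. unfold same_edge, degenerate_edge. intuition congruence. Qed.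
Lemma same_triangle_degenerate t u :
  same_triangle t u -> degenerate_triangle t -> degenerate_triangle u.
Proof.
  intros H Hd Hn. apply Hd. eapply Permutation_NoDup; [|exact Hn].
  now apply Permutation_sym.
Qed.

Definition d0 (g : X -> bool) (e : X * X) : bool := xorb (g (fst e)) (g (snd e)).
Definition d1 (g : X * X -> bool) (t : X * X * X) : bool :=
  match t with (a, b, c) => xorb (xorb (g (b, c)) (g (a, c))) (g (a, b)) end.
Definition bd_triangle (t : X * X * X) : list (X * X) :=
  match t with (a, b, c) => [(b, c); (a, c); (a, b)] end.
Definition bd (c : list (X * X * X)) : list (X * X) := flat_map bd_triangle c.

Lemma xsum_bd g c : xsum g (bd c) = xsum (d1 g) c.
Proof.
  induction c as [|[[a b] e] c IH]; simpl; [reflexivity|].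
  rewrite IH. now rewrite !xorb_assoc.
Qed.

Lemma length_bd c : length (bd c) = 3 * length c.
Proof. induction c as [|[[a b] e] c IH]; simpl; lia. Qed.

Lemma in_bd e c : In e (bd c) -> exists t, In t c /\ In (fst e) (vertices t) /\ In (snd e) (vertices t).
Proof.
  unfold bd. rewrite in_flat_map. intros ([[a b] f] & Ht & He).
  exists (a, b, f). split; [exact Ht|].
  simpl in *. intuition subst; simpl; auto.
Qed.

Lemma d0_cochain1 g : cochain1 (d0 g).
Proof.
  split; intros; unfold d0; simpl; [apply xorb_comm|apply xorb_nilpotent].
Qed.

Lemma d1_d0 g t : d1 (d0 g) t = false.
Proof. destruct t as [[a b] c]. unfold d0; simpl. destruct (g a), (g b), (g c); reflexivity. Qed.

Lemma d1_cochain2 g : cochain1 g -> cochain2 (d1 g).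
Proof.
  intros [H1 H2]. repeat split; intros; simpl.
  - rewrite (H1 a b). destruct (g (a, c)), (g (b, c)); reflexivity.
  - rewrite (H1 b c). destruct (g (a, c)), (g (a, b)), (g (c, b)); reflexivity.
  - rewrite H2. now destruct (g (a, b)).
Qed.

(** The boundary of [c] is [z] as a mod 2 chain: [d1] is the transpose of [bd], and cochains
    separate chains. *)
Definition fills (c : list (X * X * X)) (z : list (X * X)) : Prop :=
  forall g, cochain1 g -> xsum (d1 g) c = xsum g z.
Definition is_cycle (z : list (X * X)) : Prop :=
  forall g : X -> bool, xsum (d0 g) z = false.

Lemma fills_app c z c' z' : fills c z -> fills c' z' -> fills (c ++ c') (z ++ z').
Proof. intros H H' g Hg. rewrite !xsum_app. now rewrite H, H'. Qed.

(** * Edge paths *)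

Fixpoint edges (x : X) (l : list X) : list (X * X) :=
  match l with
  | [] => []
  | y :: l' => (x, y) :: edges y l'
  end.
Fixpoint lst (x : X) (l : list X) : X :=
  match l with
  | [] => x
  | y :: l' => lst y l'
  end.

Lemma lst_app x l m : lst x (l ++ m) = lst (lst x l) m.
Proof. revert x; induction l; simpl; auto. Qed.

Lemma edges_app x l m : edges x (l ++ m) = edges x l ++ edges (lst x l) m.
Proof. revert x; induction l; simpl; intros; f_equal; auto. Qed.

Lemma length_edges x l : length (edges x l) = length l.
Proof. revert x; induction l; simpl; auto. Qed.

Lemma lst_in x l : In (lst x l) (x :: l).
Proof.
  revert x. induction l as [|y l IH]; intros x; [now left|].
  right. apply IH.
Qed.

Lemma in_edges e x l : In e (edges x l) -> In (fst e) (x :: l) /\ In (snd e) l.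
Proof.
  revert x. induction l as [|y l IH]; simpl; [tauto|].
  intros x [<-|H]; simpl; auto.
  destruct (IH _ H) as [[H1|H1] H2]; auto.
Qed.

Lemma xsum_d0_edges g x l : xsum (d0 g) (edges x l) = xorb (g x) (g (lst x l)).
Proof.
  revert x. induction l as [|y l IH]; intros x; simpl; [now rewrite xorb_nilpotent|].
  rewrite IH. unfold d0; simpl. destruct (g x), (g y), (g (lst y l)); reflexivity.
Qed.

Definition cone (o : X) (z : list (X * X)) : list (X * X * X) :=
  map (fun e => (o, fst e, snd e)) z.

Lemma xsum_d1_cone g o x l :
  xsum (d1 g) (cone o (edges x l)) =
  xorb (xsum g (edges x l)) (xorb (g (o, x)) (g (o, lst x l))).
Proof.
  unfold cone. revert x. induction l as [|y l IH]; intros x; simpl.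
  - now rewrite xorb_nilpotent.
  - rewrite IH.
    destruct (g (x, y)), (g (o, x)), (g (o, y)), (g (o, lst y l)), (xsum g (edges y l));
      reflexivity.
Qed.

Lemma cone_fills o x l : lst x l = x -> fills (cone o (edges x l)) (edges x l).
Proof.
  intros H g _. rewrite xsum_d1_cone, H, xorb_nilpotent. now destruct (xsum g _).
Qed.

Lemma length_cone o z : length (cone o z) = length z.
Proof. apply length_map. Qed.

End Simplices.

Definition map_edge {X Y} (h : X -> Y) (e : X * X) : Y * Y := (h (fst e), h (snd e)).
Definition map_triangle {X Y} (h : X -> Y) (t : X * X * X) : Y * Y * Y :=
  match t with (a, b, c) => (h a, h b, h c) end.

Lemma map_edge_cochain1 {X Y} (h : X -> Y) g :
  cochain1 g -> cochain1 (fun e => g (map_edge h e)).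
Proof. intros [H1 H2]. split; intros; unfold map_edge; simpl; auto. Qed.

Lemma map_triangle_cochain2 {X Y} (h : X -> Y) f :
  cochain2 f -> cochain2 (fun t => f (map_triangle h t)).
Proof. intros (H1 & H2 & H3). repeat split; intros; simpl; auto. Qed.

Lemma fills_map {X Y} (h : X -> Y) c z :
  fills c z -> fills (map (map_triangle h) c) (map (map_edge h) z).
Proof.
  intros H g Hg. rewrite !xsum_map.
  rewrite <- (H _ (map_edge_cochain1 h Hg)).
  apply xsum_ext. intros [[a b] e] _. reflexivity.
Qed.

Lemma edges_map {X Y} (h : X -> Y) x l :
  edges (h x) (map h l) = map (map_edge h) (edges x l).
Proof. revert x; induction l; simpl; intros; f_equal; auto. Qed.

Lemma lst_map {X Y} (h : X -> Y) x l : lst (h x) (map h l) = h (lst x l).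
Proof. revert x; induction l; simpl; auto. Qed.

(** * Discrete geodesic spaces and their Rips complexes *)

Record geodesic_metric (X : Type) (d : X -> X -> nat) : Prop := {
  dist_refl : forall x, d x x = 0;
  dist_eq : forall x y, d x y = 0 -> x = y;
  dist_sym : forall x y, d x y = d y x;
  dist_tri : forall x y z, d x z <= d x y + d y z;
  dist_step : forall x y n, d x y = S n -> exists z, d x z = 1 /\ d z y = n
}.

(** The four-point condition without a base point: of the three sums of opposite distances, the
    largest exceeds the second by at most [2 * delta]. *)
Definition hyperbolic_metric (X : Type) (d : X -> X -> nat) (delta : nat) : Prop :=
  forall x y z w,
    d x y + d z w <= Nat.max (d x z + d y w) (d y z + d x w) + 2 * delta.

Definition close {X} (d : X -> X -> nat) (s : nat) (e : X * X) : Prop :=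
  d (fst e) (snd e) <= s.
Definition small {X} (d : X -> X -> nat) (s : nat) (t : X * X * X) : Prop :=
  match t with (a, b, c) => d a b <= s /\ d b c <= s /\ d a c <= s end.

Definition fillable {X} (d : X -> X -> nat) (K s : nat) (z : list (X * X)) : Prop :=
  exists c, Forall (small d s) c /\ length c <= K /\ fills c z.

Lemma list_argmax {X : Type} (f : X -> nat) (a : X) (l : list X) :
  exists v, In v (a :: l) /\ forall u, In u (a :: l) -> f u <= f v.
Proof.
  revert a. induction l as [|b l IH]; intros a.
  - exists a. split; [now left|]. intros u [->|[]]. lia.
  - destruct (IH b) as (v & Hv & Hmax).
    destruct (le_lt_dec (f a) (f v)).
    + exists v. split; [now right|]. intros u [<-|Hu]; auto.
    + exists a. split; [now left|]. intros u [<-|Hu]; [lia|].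
      specialize (Hmax u Hu). lia.
Qed.

Section Metric.
Variables (X : Type) (d : X -> X -> nat).
Hypothesis M : geodesic_metric d.

Lemma path_dist s x l v :
  Forall (close d s) (edges x l) -> In v (x :: l) -> d x v <= s * length l.
Proof.
  revert x. induction l as [|y l IH]; intros x H [<-|Hv]; simpl in *.
  - rewrite (dist_refl M). lia.
  - tauto.
  - rewrite (dist_refl M). lia.
  - inversion H as [|? ? H1 H2]; subst. unfold close in H1; simpl in H1.
    specialize (IH _ H2 Hv). pose proof (dist_tri M x y v). lia.
Qed.

Lemma geodesic_path x y :
  exists l, lst x l = y /\ length l = d x y /\ Forall (close d 1) (edges x l).
Proof.
  remember (d x y) as n eqn:E. symmetry in E. revert x E.
  induction n as [|n IH]; intros x E.
  - exists []. simpl. split; [exact (dist_eq M _ _ E)|auto].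
  - destruct (dist_step M _ _ E) as (z & Hz & Hn).
    destruct (IH z Hn) as (l & H1 & H2 & H3).
    exists (z :: l). simpl. split; [exact H1|]. split; [lia|].
    constructor; [|exact H3]. unfold close; simpl. lia.
Qed.

Lemma close_mono s s' e : s <= s' -> close d s e -> close d s' e.
Proof. unfold close. lia. Qed.

Lemma small_mono s s' t : s <= s' -> small d s t -> small d s' t.
Proof. destruct t as [[a b] c]; simpl. lia. Qed.

Lemma cone_small s o z :
  Forall (close d s) z ->
  (forall e, In e z -> d o (fst e) <= s /\ d o (snd e) <= s) ->
  Forall (small d s) (cone o z).
Proof.
  intros H1 H2. unfold cone. apply Forall_map. apply Forall_forall.
  intros e He. rewrite Forall_forall in H1. specialize (H1 e He).
  unfold close in H1. specialize (H2 e He). simpl. lia.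
Qed.

Lemma cone_path_small s x l :
  Forall (close d 1) (edges x l) -> length l <= s ->
  Forall (small d s) (cone x (edges x l)).
Proof.
  intros H Hs. destruct l as [|y l]; [constructor|]. apply cone_small.
  - eapply Forall_impl; [|exact H]. intros e. apply close_mono. simpl in Hs; lia.
  - intros e He. apply in_edges in He as [He1 He2].
    pose proof (path_dist H He1). pose proof (path_dist H (or_intror He2)). lia.
Qed.

(* Dehn's algorithm: if the arc of length [2k] around the vertex [v] of the
   loop farthest from [x] were geodesic, the four-point inequality would fail. *)
Lemma hyperbolic_filling delta :
  hyperbolic_metric d delta ->
  forall x l, lst x l = x -> Forall (close d 1) (edges x l) ->
    fillable d ((8 * delta + 4) * length l) (8 * delta + 4) (edges x l).
Proof.
  intros H4 x l. remember (length l) as n eqn:En.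
  (* The least [k] with [2 * k > k + 2 * delta], the inequality that contradicts the four-point
     condition. *)
  set (k := 2 * delta + 1). replace (8 * delta + 4) with (4 * k) by lia.
  revert x l En. induction n as [n IH] using lt_wf_ind. intros x l En Hcl Hst.
  destruct (list_argmax (d x) x l) as (v & Hv & Hmax).
  destruct (le_lt_dec (d x v) (2 * k)) as [Hnear|Hfar].
  - exists (cone x (edges x l)). split; [|split].
    + apply cone_small.
      * eapply Forall_impl; [|exact Hst]. intros e. apply close_mono. lia.
      * intros e He. apply in_edges in He as [He1 He2].
        pose proof (Hmax _ He1). pose proof (Hmax _ (or_intror He2)). lia.
    + rewrite length_cone, length_edges, <- En. nia.
    + now apply cone_fills.
  - destruct Hv as [<-|Hv]; [rewrite (dist_refl M) in Hfar; lia|].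
    apply in_split in Hv as (l1 & l2 & El).
    set (P := l1 ++ [v]).
    assert (EP : l = P ++ l2) by (unfold P; rewrite <- app_assoc; exact El).
    assert (HvP : lst x P = v) by (unfold P; now rewrite lst_app).
    rewrite EP, edges_app, HvP in Hst. apply Forall_app in Hst as [Hst1 Hst2].
    assert (Hl2 : lst v l2 = x) by (rewrite <- HvP, <- lst_app, <- EP; exact Hcl).
    assert (HP : 2 * k < length P).
    { pose proof (path_dist Hst1 (lst_in x P)). rewrite HvP in H. lia. }
    assert (HL2 : 2 * k < length l2).
    { pose proof (path_dist Hst2 (lst_in v l2)). rewrite Hl2, (dist_sym M) in H. lia. }
    set (A := firstn (length P - k) P). set (B := skipn (length P - k) P).
    set (C := firstn k l2). set (D := skipn k l2).
    assert (EAB : P = A ++ B) by (symmetry; apply firstn_skipn).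
    assert (ECD : l2 = C ++ D) by (symmetry; apply firstn_skipn).
    assert (LB : length B = k) by (unfold B; rewrite length_skipn; lia).
    assert (LC : length C = k) by (unfold C; rewrite length_firstn; lia).
    assert (HvPin : In v P) by (apply in_app_iff; right; now left).
    clearbody A B C D P. clear El. subst P l2 l.
    set (y1 := lst x A) in *. set (y2 := lst v C).
    rewrite lst_app in HvP, Hl2. fold y1 in HvP. fold y2 in Hl2.
    rewrite edges_app in Hst1, Hst2. fold y1 in Hst1. fold y2 in Hst2.
    apply Forall_app in Hst1 as [HA HB]. apply Forall_app in Hst2 as [HC HD].
    assert (Dy1 : d x y1 <= d x v).
    { apply Hmax. destruct (lst_in x A) as [H|H]; [now left|].
      right. fold y1 in H. rewrite !in_app_iff. tauto. }
    assert (Dy2 : d x y2 <= d x v).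
    { apply Hmax. destruct (lst_in v C) as [H|H].
      - right. fold y2 in H. rewrite <- H, in_app_iff. left.
        exact HvPin.
      - right. fold y2 in H. rewrite !in_app_iff. tauto. }
    pose proof (path_dist HB (lst_in y1 B)) as D1. rewrite HvP, LB in D1.
    pose proof (path_dist HC (lst_in v C)) as D2. fold y2 in D2. rewrite LC in D2.
    destruct (le_lt_dec (2 * k) (d y1 y2)) as [Hge|Hlt].
    { exfalso. pose proof (H4 x v y1 y2) as H. rewrite (dist_sym M v y1) in H. lia. }
    destruct (geodesic_path y1 y2) as (Q & HQ1 & HQ2 & HQ3).
    destruct (IH (length (A ++ Q ++ D))) with (x := x) (l := A ++ Q ++ D)
      as (c & Hc1 & Hc2 & Hc3).
    { rewrite En, !length_app. lia. }
    { reflexivity. }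
    { rewrite !lst_app. fold y1. now rewrite HQ1. }
    { rewrite !edges_app. fold y1. rewrite HQ1. rewrite !Forall_app. auto. }
    (* Coning off the arc and the geodesic [Q] costs fewer than [4 * k] triangles, paid for by the
       loop losing at least one edge. *)
    exists (c ++ cone y1 (edges y1 (B ++ C)) ++ cone y1 (edges y1 Q)). split; [|split].
    + rewrite !Forall_app. split; [exact Hc1|]. split; apply cone_path_small.
      * rewrite edges_app, HvP, Forall_app. auto.
      * rewrite length_app. lia.
      * exact HQ3.
      * lia.
    + rewrite !length_app in *. rewrite !length_cone, !length_edges, length_app in *.
      nia.
    + intros g Hg. rewrite !xsum_app, (Hc3 g Hg), !xsum_d1_cone.
      rewrite !edges_app, !lst_app. fold y1. rewrite HvP, HQ1. fold y2.
      rewrite !xsum_app.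
      destruct (xsum g (edges x A)), (xsum g (edges y1 B)), (xsum g (edges v C)),
        (xsum g (edges y2 D)), (xsum g (edges y1 Q)), (g (y1, y1)), (g (y1, y2));
        reflexivity.
Qed.

(** * From unit steps to edges of length at most [s], and from loops to cycles *)

Lemma subdivide s x l :
  1 <= s -> Forall (close d s) (edges x l) ->
  exists l' c, lst x l' = lst x l /\ length l' <= s * length l /\
    Forall (close d 1) (edges x l') /\ Forall (small d s) c /\
    length c <= s * length l /\
    fills c (edges x l ++ edges x l').
Proof.
  intros Hs. revert x. induction l as [|y l IH]; intros x H.
  - exists [], []. simpl. repeat split; auto; lia.
  - simpl in H. inversion H as [|? ? H1 H2]; subst. unfold close in H1; simpl in H1.
    destruct (IH y H2) as (l' & c & E1 & E2 & E3 & E4 & E5 & E6).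
    destruct (geodesic_path x y) as (P & P1 & P2 & P3).
    exists (P ++ l'), (cone x (edges x P) ++ c).
    rewrite lst_app, edges_app, P1, !length_app, length_cone, length_edges.
    split; [exact E1|]. split; [simpl; lia|].
    split; [apply Forall_app; auto|].
    split; [apply Forall_app; split; [apply cone_path_small; [auto|lia]|auto]|].
    split; [simpl; lia|].
    intros g Hg. simpl. rewrite !xsum_app, xsum_d1_cone, P1, (E6 g Hg), !xsum_app.
    rewrite (proj2 Hg x).
    destruct (g (x, y)), (xsum g (edges x P)), (xsum g (edges y l)), (xsum g (edges y l'));
      reflexivity.
Qed.

(** Subdividing costs [s] triangles per edge and gives a unit-step loop at most [s] times as long,
    whence the factor [(K + 1) * s]. *)
Lemma coarse_loop_filling K s0 s :
  1 <= s -> s0 <= s ->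
  (forall x l, lst x l = x -> Forall (close d 1) (edges x l) ->
     fillable d (K * length l) s0 (edges x l)) ->
  forall x l, lst x l = x -> Forall (close d s) (edges x l) ->
    fillable d ((K + 1) * s * length l) s (edges x l).
Proof.
  intros Hs H0 HK x l Hcl Hst.
  destruct (@subdivide s x l Hs Hst) as (l' & c & E1 & E2 & E3 & E4 & E5 & E6).
  destruct (HK x l') as (c' & C1 & C2 & C3); [congruence|exact E3|].
  exists (c ++ c'). split; [|split].
  - apply Forall_app. split; [exact E4|].
    eapply Forall_impl; [|exact C1]. intros t. now apply small_mono.
  - rewrite length_app. nia.
  - intros g Hg. rewrite xsum_app, (E6 g Hg), (C3 g Hg), xsum_app.
    destruct (xsum g (edges x l)), (xsum g (edges x l')); reflexivity.
Qed.

(** An Euler trail: if the boundary of [z] is [a + b] with [a] different from [b], the indicator of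
    [a] detects an edge at [a]; follow it and repeat from its other end. *)
Lemma extract_path s a b z :
  Forall (close d s) z ->
  (forall g : X -> bool, xsum (d0 g) z = xorb (g a) (g b)) ->
  exists l rest, lst a l = b /\ length l + length rest = length z /\
    Forall (close d s) (edges a l) /\ Forall (close d s) rest /\
    forall g, cochain1 g -> xsum g z = xorb (xsum g (edges a l)) (xsum g rest).
Proof.
  remember (length z) as n eqn:En. revert a z En.
  induction n as [|n IH]; intros a z En Hs Hb.
  - destruct z; [|discriminate]. exists [], []. simpl. repeat split; auto.
    apply NNPP. intros Hab. specialize (Hb (fun x => dec (x = a))). simpl in Hb.
    rewrite (@dec_intro (a = a)), (@dec_intro_not (b = a)) in Hb; auto. discriminate.
  - destruct (classic (a = b)) as [->|Hab].
    { exists [], z. simpl. repeat split; auto. }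
    assert (Ht : xsum (d0 (fun x => dec (x = a))) z = true).
    { rewrite Hb, (@dec_intro (a = a)), (@dec_intro_not (b = a)); auto. }
    apply xsum_true in Ht as ([u v] & Hin & Huv). unfold d0 in Huv. simpl in Huv.
    apply in_split in Hin as (z1 & z2 & ->).
    assert (exists a', same_edge (u, v) (a, a')) as [a' Ha'].
    { unfold same_edge. simpl.
      destruct (dec (u = a)) eqn:E1, (dec (v = a)) eqn:E2; try discriminate.
      - apply dec_elim in E1. exists v. auto.
      - apply dec_elim in E2. exists u. auto. }
    rewrite length_app in En. simpl in En.
    apply Forall_app in Hs as [Hs1 Hs2]. inversion Hs2 as [|? ? Hs3 Hs4]; subst.
    destruct (IH a' (z1 ++ z2)) as (l & rest & L1 & L2 & L3 & L4 & L5).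
    + rewrite length_app. lia.
    + apply Forall_app; auto.
    + intros g. specialize (Hb g). rewrite xsum_app in Hb |- *. simpl in Hb.
      rewrite (proj1 (cochain1_admissible (d0_cochain1 g)) _ _ Ha') in Hb.
      unfold d0 at 2 in Hb; simpl in Hb.
      destruct (xsum (d0 g) z1), (xsum (d0 g) z2), (g a), (g a'), (g b);
        simpl in *; congruence.
    + exists (a' :: l), rest. simpl. split; [exact L1|]. split; [lia|].
      split; [constructor; [|exact L3]|split; [exact L4|]].
      * unfold close in *. simpl in *.
        destruct Ha' as [[? ?]|[? ?]]; simpl in *; subst; auto.
        now rewrite (dist_sym M).
      * intros g Hg. specialize (L5 g Hg). rewrite xsum_app in *. simpl.
        rewrite (proj1 (cochain1_admissible Hg) _ _ Ha').
        destruct (xsum g z1), (xsum g z2), (g (a, a')), (xsum g (edges a' l)),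
          (xsum g rest); simpl in *; congruence.
Qed.

(** Removing one edge of a cycle leaves a chain that contains a path joining its endpoints. The
    cycle thus splits into closed loops with the same total number of edges. *)
Lemma cycle_filling K s :
  (forall x l, lst x l = x -> Forall (close d s) (edges x l) ->
     fillable d (K * length l) s (edges x l)) ->
  forall z, Forall (close d s) z -> is_cycle z -> fillable d (K * length z) s z.
Proof.
  intros HK z. remember (length z) as n eqn:En. revert z En.
  induction n as [n IH] using lt_wf_ind. intros z En Hs Hz.
  destruct z as [|[a b] z].
  - exists []. repeat split; simpl; auto; lia.
  - inversion Hs as [|? ? Hs1 Hs2]; subst.
    destruct (@extract_path s b a z Hs2) as (l & rest & L1 & L2 & L3 & L4 & L5).
    { intros g. specialize (Hz g). simpl in Hz. unfold d0 at 1 in Hz. simpl in Hz.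
      destruct (xsum (d0 g) z), (g a), (g b); simpl in *; congruence. }
    simpl length in *.
    destruct (HK a (b :: l)) as (c & C1 & C2 & C3); [exact L1|now constructor|].
    destruct (IH (length rest)) with (z := rest) as (c' & C1' & C2' & C3'); auto; [lia| |].
    { intros g. specialize (Hz g). simpl in Hz.
      rewrite (L5 _ (d0_cochain1 g)), xsum_d0_edges, L1 in Hz.
      unfold d0 at 1 in Hz. simpl in Hz.
      destruct (xsum (d0 g) rest), (g a), (g b); simpl in *; congruence. }
    exists (c ++ c'). split; [apply Forall_app; auto|]. split.
    + rewrite length_app. simpl in C2. nia.
    + intros g Hg. rewrite xsum_app, (C3 g Hg), (C3' g Hg). simpl.
      rewrite (L5 g Hg). now rewrite xorb_assoc.
Qed.

(** * Two-cycles in the Rips complex of a hyperbolic space *)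

Definition cocycle2 (R : nat) (f : X * X * X -> bool) : Prop :=
  forall a b c e, d a b <= R -> d a c <= R -> d a e <= R -> d b c <= R ->
    d b e <= R -> d c e <= R ->
    xorb (xorb (f (b, c, e)) (f (a, c, e))) (xorb (f (a, b, e)) (f (a, b, c))) = false.

Definition weight (w : X) (c : list (X * X * X)) : nat :=
  list_sum (map (d w) (flat_map (@vertices X) c)).

Lemma point_towards x w k : k <= d x w -> exists y, d x y = k /\ d y w = d x w - k.
Proof.
  revert x. induction k as [|k IH]; intros x Hk.
  - exists x. rewrite (dist_refl M). lia.
  - destruct (d x w) as [|n] eqn:E; [lia|].
    destruct (dist_step M _ _ E) as (z & Hz & Hn).
    destruct (IH z) as (y & Hy1 & Hy2); [lia|].
    exists y. pose proof (dist_tri M x z y). pose proof (dist_tri M x y w). lia.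
Qed.

Lemma weight_decreases w x x' c :
  d w x' < d w x -> In x (flat_map (@vertices X) c) ->
  weight w (map (map_triangle (fun v => if dec (v = x) then x' else v)) c) < weight w c.
Proof.
  intros Hlt. set (sg := fun v => if dec (v = x) then x' else v).
  unfold weight.
  replace (flat_map (@vertices X) (map (map_triangle sg) c))
    with (map sg (flat_map (@vertices X) c)).
  2:{ induction c as [|[[a b] e] c IH]; simpl; [reflexivity|]. now rewrite IH. }
  induction (flat_map (@vertices X) c) as [|v l IH]; simpl; [tauto|].
  assert (Hle : forall m, list_sum (map (d w) (map sg m)) <= list_sum (map (d w) m)).
  { induction m as [|u m IHm]; simpl; [lia|]. unfold sg at 1.
    destruct (dec (u = x)) eqn:E; [apply dec_elim in E; subst|]; lia. }
  intros [<-|Hin].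
  - unfold sg at 1. rewrite dec_intro by reflexivity. specialize (Hle l). lia.
  - specialize (IH Hin). unfold sg at 1.
    destruct (dec (v = x)) eqn:E; [apply dec_elim in E; subst|]; lia.
Qed.

(* Rips' contraction: in the four-point inequality, moving the vertex [x]
   farthest from [w] towards [w] keeps it adjacent to all its neighbours. *)
Lemma rips_two_cycle delta R f (w : X) c :
  hyperbolic_metric d delta -> 4 * delta + 2 <= R -> cochain2 f -> cocycle2 R f ->
  Forall (small d R) c -> (forall g, cochain1 g -> xsum (d1 g) c = false) ->
  xsum f c = false.
Proof.
  intros H4 HR Hf Hcf. remember (weight w c) as n eqn:En. revert c En.
  induction n as [n IH] using lt_wf_ind. intros c En Hs Hc.
  pose proof (dist_refl M) as dr. pose proof (dist_sym M) as ds.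
  pose proof (dist_tri M) as dt.
  set (k := 2 * delta + 1) in *.
  destruct Hf as (F1 & F2 & F3).
  assert (F4 : forall a b, f (a, b, b) = false) by (intros; rewrite F1, F2; auto).
  destruct (list_argmax (d w) w (flat_map (@vertices X) c)) as (x & Hx & Hmax).
  assert (Hv : forall t v, In t c -> In v (vertices t) -> d w v <= d w x).
  { intros t v Ht Hvt. apply Hmax. right. apply in_flat_map. eauto. }
  rewrite Forall_forall in Hs.
  destruct (le_lt_dec (d w x) k) as [Hnear|Hfar].
  (* Once all vertices are within [R] of [w], the cocycle condition makes [f] the coboundary of its
     contraction with [w], which vanishes on the cycle. *)
  - rewrite <- (Hc (fun e => f (w, fst e, snd e))).
    2:{ split; intros; simpl; auto. }
    apply xsum_ext. intros [[a b] e] Ht.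
    pose proof (Hs _ Ht) as Hsm. simpl in Hsm.
    pose proof (Hv _ a Ht ltac:(simpl; auto)). pose proof (Hv _ b Ht ltac:(simpl; auto)).
    pose proof (Hv _ e Ht ltac:(simpl; auto)).
    assert (HC := @Hcf w a b e). simpl.
    destruct (f (a, b, e)), (f (w, b, e)), (f (w, a, e)), (f (w, a, b));
      try reflexivity; exfalso; simpl in HC; enough (true = false) by discriminate;
      apply HC; lia.
  - destruct Hx as [<-|Hx]; [rewrite dr in Hfar; lia|].
    destruct (@point_towards x w k) as (x' & Hx1 & Hx2); [rewrite ds; lia|].
    rewrite (ds x w) in Hx2.
    set (sg := fun v => if dec (v = x) then x' else v).
    (* As [x'] is closer to [w] than [x] by [k], the four-point inequality bounds [d x' y] by the
       larger of [R - k] and [k], plus [2 * delta]; both values are at most [R]. *)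
    assert (Hadj : forall y, d x y <= R -> d w y <= d w x -> d x' y <= R).
    { intros y H1 H2. pose proof (H4 x' y w x) as H.
      rewrite (ds y x), (ds y w), (ds x' x) in H. lia. }
    (* The chain homotopy between the identity and [sg]: an edge from [x] to [y] goes to the
       triangle [x], [x'], [y], other edges to zero. On [c], then, [f] and its pull-back by [sg]
       differ by [d1 g]. *)
    set (g := fun e : X * X => if dec (fst e = snd e) then false
         else if dec (fst e = x) then f (x, x', snd e)
         else if dec (snd e = x) then f (x, x', fst e) else false).
    assert (Hg : cochain1 g).
    { split.
      - intros a b. unfold g. simpl.
        destruct (classic (a = b)) as [->|nab]; [reflexivity|].
        rewrite (@dec_intro_not (a = b)), (@dec_intro_not (b = a)) by congruence.
        destruct (dec (a = x)) eqn:E1, (dec (b = x)) eqn:E2; auto.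
        apply dec_elim in E1, E2. congruence.
      - intros a. unfold g. simpl. now rewrite dec_intro. }
    assert (Hsg : forall t, In t c -> f t = xorb (f (map_triangle sg t)) (d1 g t) /\
                               small d R (map_triangle sg t)).
    { assert (Hgx : forall y, y <> x -> g (x, y) = f (x, x', y)).
      { intros y ny. unfold g. simpl. rewrite dec_intro_not, dec_intro; auto. }
      assert (Hg0 : forall y z, y <> x -> z <> x -> g (y, z) = false).
      { intros y z n1 n2. unfold g. simpl.
        destruct (dec (y = z)); rewrite ?(@dec_intro_not (_ = x)); auto. }
      assert (Hk : k <= R) by lia.
      assert (Hcoc : forall b e, d x b <= R -> d x e <= R -> d b e <= R ->
                d w b <= d w x -> d w e <= d w x ->
                f (x, b, e) = xorb (f (x', b, e)) (xorb (f (x, x', b)) (f (x, x', e)))).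
      { intros b e H1 H2 H3 H5 H6.
        assert (HC := @Hcf x x' b e).
        destruct (f (x, b, e)), (f (x', b, e)), (f (x, x', b)), (f (x, x', e));
          try reflexivity; exfalso; simpl in HC; enough (true = false) by discriminate;
          apply HC; auto; lia. }
      intros [[a b] e] Ht.
      pose proof (Hs _ Ht) as (S1 & S2 & S3).
      pose proof (Hv _ a Ht ltac:(simpl; auto)) as Wa.
      pose proof (Hv _ b Ht ltac:(simpl; auto)) as Wb.
      pose proof (Hv _ e Ht ltac:(simpl; auto)) as We.
      unfold map_triangle, d1, small, sg.
      destruct (classic (a = x)) as [Ea|Na]; destruct (classic (b = x)) as [Eb|Nb];
        destruct (classic (e = x)) as [Ee|Ne]; subst;
        rewrite ?(@dec_intro (x = x)) by reflexivity;
        rewrite ?(@dec_intro_not (_ = x)) by assumption;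
        rewrite ?(proj2 Hg), ?dr, ?(proj1 Hg _ x), ?Hgx, ?Hg0, ?(ds _ x'), ?F3, ?F4 by assumption;
        rewrite ?(ds _ x) in *;
        (split; [|repeat split; auto; lia]).
      - reflexivity.
      - now destruct (f (x, x', e)).
      - rewrite (F2 x b x), (F2 x' b x'), !F3. now destruct (f (x, x', b)).
      - rewrite Hcoc by (auto; lia).
        destruct (f (x', b, e)), (f (x, x', b)), (f (x, x', e)); reflexivity.
      - now destruct (f (x, x', a)).
      - rewrite (F1 a x e), (F1 a x' e), Hcoc by (auto; lia).
        destruct (f (x', a, e)), (f (x, x', a)), (f (x, x', e)); reflexivity.
      - rewrite (F2 a b x), (F2 a b x'), (F1 a x b), (F1 a x' b), Hcoc by (auto; lia).
        destruct (f (x', a, b)), (f (x, x', a)), (f (x, x', b)); reflexivity.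
      - now destruct (f (a, b, e)). }
    rewrite (@xsum_ext _ f (fun t => xorb (f (map_triangle sg t)) (d1 g t)))
      by (intros t Ht; apply (Hsg t Ht)).
    rewrite xsum_xorb, (Hc g Hg), <- xsum_map.
    rewrite (IH (weight w (map (map_triangle sg) c))) with (c := map (map_triangle sg) c);
      [reflexivity| |reflexivity| |].
    + rewrite En. apply weight_decreases; [rewrite ds; lia|exact Hx].
    + apply Forall_map, Forall_forall. intros t Ht. apply (Hsg t Ht).
    + intros h Hh. rewrite xsum_map, <- (Hc _ (map_edge_cochain1 sg Hh)).
      apply xsum_ext. intros [[a b] e] _. reflexivity.
Qed.
End Metric.

(** * Linear filling implies exponential divergence of geodesics *)

Lemma reduced_filter A (E : A -> A -> Prop) deg p l :
  reduced E deg l -> reduced E deg (filter p l).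
Proof.
  intros [H1 H2]. induction l as [|a l IH]; simpl; [split; constructor|].
  inversion H1; inversion H2; subst.
  destruct IH as [I1 I2]; auto.
  destruct (p a); split; auto; constructor; auto.
  eapply incl_Forall; [|eassumption]. apply incl_filter.
Qed.

Section Divergence.
Variables (X : Type) (d : X -> X -> nat).
Hypothesis M : geodesic_metric d.
Variables K s : nat.
Hypothesis Hs : 1 <= s.
Hypothesis iso : forall z, Forall (close d s) z -> is_cycle z -> fillable d (K * length z) s z.

(** A ball in a minimal filling has area at most [K] times the length of its boundary, and this
    length is at most [1 + s] times the number of edges of shell triangles, three for each. Adding
    one keeps [kappa] positive. *)
Let kappa := 3 * K * (1 + s) + 1.

Definition geodesic (gm : nat -> X) (L : nat) : Prop :=
  forall i j, i <= j -> j <= L -> d (gm i) (gm j) = j - i.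
Definition geodesic_edge (gm : nat -> X) (i : nat) : X * X := (gm i, gm (S i)).
Definition geodesic_edges (gm : nat -> X) (a n : nat) : list (X * X) :=
  map (geodesic_edge gm) (seq a n).

Lemma geodesic_edge_inj gm L i j :
  geodesic gm L -> i < L -> j < L ->
  same_edge (geodesic_edge gm i) (geodesic_edge gm j) -> i = j.
Proof.
  intros Hg Hi Hj HE.
  assert (Hinj : forall a b, a <= L -> b <= L -> gm a = gm b -> a = b).
  { intros a b Ha Hb E. pose proof (dist_refl M (gm a)) as D. rewrite E in D at 2.
    destruct (le_lt_dec a b).
    - rewrite (Hg a b) in D; lia.
    - rewrite (dist_sym M), (Hg b a) in D; lia. }
  destruct HE as [[E1 E2]|[E1 E2]]; simpl in *.
  - apply Hinj; auto; lia.
  - apply Hinj in E1; [|lia..]. apply Hinj in E2; lia.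
Qed.

Lemma geodesic_edges_reduced gm L a n :
  geodesic gm L -> a + n <= L ->
  reduced (@same_edge X) (@degenerate_edge X) (geodesic_edges gm a n).
Proof.
  intros Hg. unfold geodesic_edges. revert a. induction n as [|n IH]; intros a Ha; simpl.
  - split; constructor.
  - destruct (IH (S a)) as [H1 H2]; [lia|]. split; constructor; auto.
    + unfold degenerate_edge. simpl. intros E.
      pose proof (dist_refl M (gm a)) as D. rewrite E in D at 2.
      rewrite (Hg a (S a)) in D; lia.
    + apply Forall_map, Forall_forall. intros i Hi. apply in_seq in Hi.
      intros HE. apply (@geodesic_edge_inj gm L) in HE; auto; lia.
Qed.

Lemma xsum_d0_geodesic_edges g gm a n :
  xsum (d0 g) (geodesic_edges gm a n) = xorb (g (gm a)) (g (gm (a + n))).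
Proof.
  unfold geodesic_edges. revert a. induction n as [|n IH]; intros a; simpl.
  - now rewrite Nat.add_0_r, xorb_nilpotent.
  - rewrite IH. unfold d0. simpl. rewrite Nat.add_succ_r.
    destruct (g (gm a)), (g (gm (S a))), (g (gm (S (a + n)))); reflexivity.
Qed.

Lemma bd_close c e : Forall (small d s) c -> In e (bd c) -> close d s e.
Proof.
  intros H. unfold bd. rewrite in_flat_map. intros ([[a b] f] & Ht & He).
  rewrite Forall_forall in H. specialize (H _ Ht). simpl in *. unfold close.
  intuition subst; simpl; auto.
Qed.

Lemma small_vertices t u v :
  small d s t -> In u (vertices t) -> In v (vertices t) -> d u v <= s.
Proof.
  destruct t as [[a b] c]. simpl. intros (H1 & H2 & H3).
  pose proof (dist_refl M). pose proof (dist_sym M).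
  intuition subst; rewrite ?H in *; auto; try lia;
  rewrite H0; auto.
Qed.

Lemma length_flat_map_seq A (h : A -> nat) n l :
  length (flat_map (fun e => seq (h e) n) l) = n * length l.
Proof.
  induction l; simpl; [lia|]. rewrite length_app, length_seq, IHl. lia.
Qed.

(** * Growth of balls in a minimal filling *)

Section Ball.
Variables (gm : nat -> X) (L i0 : nat) (z' : list (X * X)) (D : nat).
Variable c : list (X * X * X).
Hypothesis Hgm : geodesic gm L.
Hypothesis Hi0 : i0 < L.
Hypothesis Hfar : forall e, In e z' -> D < d (gm i0) (fst e).
Hypothesis Hsm : Forall (small d s) c.
Hypothesis Hfill : fills c (geodesic_edges gm 0 L ++ z').
Hypothesis Hmin : forall c', Forall (small d s) c' ->
  fills c' (geodesic_edges gm 0 L ++ z') -> length c <= length c'.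

Let near (k : nat) (t : X * X * X) : bool :=
  dec (exists v, In v (vertices t) /\ d (gm i0) v <= k).
Definition ball_area (k : nat) : nat := length (filter (near k) c).

Lemma near_mono k k' t : k <= k' -> near k t = true -> near k' t = true.
Proof.
  intros Hk H. apply dec_elim in H as (v & Hv & Hd). apply dec_intro.
  exists v. split; [exact Hv|lia].
Qed.

Lemma ball_area_mono k k' : k <= k' -> ball_area k <= ball_area k'.
Proof.
  intros Hk. unfold ball_area. rewrite (@filter_length_diff _ (near k) (near k')); [lia|].
  intros t. now apply near_mono.
Qed.

(** The edge of the geodesic at [gm i0] occurs exactly once in the cycle, since edges of [z'] start
    at distance more than one. So it survives in the boundary of [c] and lies in one of its
    triangles. *)
Lemma ball_area_pos : 1 <= D -> 1 <= ball_area 0.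
Proof.
  intros HD. set (t := geodesic_edge gm i0).
  pose proof (@geodesic_edges_reduced gm L 0 L Hgm ltac:(lia)) as Hred.
  assert (Hin : In t (geodesic_edges gm 0 L)).
  { apply in_map, in_seq. lia. }
  assert (Hnd : ~ degenerate_edge t).
  { destruct Hred as [H _]. rewrite Forall_forall in H. auto. }
  assert (Hadm : cochain1 (class_of (@same_edge X) t)).
  { apply admissible_cochain1, class_of_admissible; auto using same_edge_sym.
    - apply same_edge_trans.
    - apply same_edge_degenerate. }
  assert (Hx : xsum (class_of (@same_edge X) t) (bd c) = true).
  { rewrite xsum_bd, (Hfill Hadm), xsum_app.
    rewrite (@xsum_class_of _ _ (@degenerate_edge X));
      auto using same_edge_refl, same_edge_sym.
    rewrite xsum_zero; [reflexivity|]. intros e He. apply dec_intro_not.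
    intros HE. specialize (Hfar e He).
    pose proof (dist_refl M (gm i0)). assert (d (gm i0) (gm (S i0)) = 1) by (rewrite Hgm; lia).
    destruct HE as [[E1 E2]|[E1 E2]]; simpl in *.
    - rewrite <- E1 in Hfar. lia.
    - rewrite <- E2 in Hfar. lia. }
  apply xsum_true in Hx as (e & He & Ht). apply dec_elim in Ht.
  apply in_bd in He as (T & HT & V1 & V2).
  unfold ball_area. destruct (filter (near 0) c) eqn:EF; [|simpl; lia].
  exfalso. assert (HI : In T (filter (near 0) c)); [|now rewrite EF in HI].
  apply filter_In. split; [exact HT|]. apply dec_intro. exists (gm i0).
  rewrite (dist_refl M). split; [|lia].
  destruct Ht as [[E1 E2]|[E1 E2]]; simpl in *; congruence.
Qed.

(* The boundary of the part of [c] near [gm i0] consists of edges of triangles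
   in the shell between radii [k] and [k + s] and of edges of the geodesic; the
   function [d (gm 0) _] shows that each of the latter is covered by one of the
   former, which bounds the length of this boundary by the area of the shell. *)
Lemma ball_area_step k :
  k + s <= D -> (kappa + 1) * ball_area k <= kappa * ball_area (k + s).
Proof.
  intros HkD. set (ck := filter (near k) c).
  set (cn := filter (fun t => negb (near k t)) c).
  assert (Hck : Forall (small d s) ck) by (eapply incl_Forall; [apply incl_filter|eauto]).
  assert (Hcn : Forall (small d s) cn) by (eapply incl_Forall; [apply incl_filter|eauto]).
  destruct (reduced_representative (@same_edge X) (@degenerate_edge X) (bd ck))
    as (zk & Zin & Zred & Zf).
  assert (Zg : forall g, cochain1 g -> xsum g zk = xsum (d1 g) ck).
  { intros g Hg. rewrite Zf by now apply cochain1_admissible. apply xsum_bd. }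
  assert (Zcyc : is_cycle zk).
  { intros g. rewrite (Zg _ (d0_cochain1 g)). apply xsum_zero. intros; apply d1_d0. }
  assert (Zcl : Forall (close d s) zk).
  { apply Forall_forall. intros e He. eapply bd_close; [exact Hck|auto]. }
  destruct (iso Zcl Zcyc) as (w & W1 & W2 & W3).
  (* Replacing the near part by a linear filling of its boundary gives another filling of the same
     cycle, so minimality bounds the area. *)
  assert (HW : ball_area k <= K * length zk).
  { assert (length c <= length (w ++ cn)).
    { apply Hmin; [apply Forall_app; auto|]. intros g Hg.
      rewrite xsum_app, (W3 g Hg), (Zg g Hg), <- (Hfill Hg). symmetry. apply xsum_filter. }
    pose proof (filter_length (near k) c) as HF. rewrite length_app in *.
    unfold ball_area. unfold cn in *. lia. }
  assert (Zv : forall t, In t zk -> d (gm i0) (fst t) <= k + s /\ d (gm i0) (snd t) <= k + s).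
  { intros t Ht. apply Zin, in_bd in Ht as (T & HT & V1 & V2).
    rewrite Forall_forall in Hck. specialize (Hck T HT).
    apply filter_In in HT as [HT Hn]. apply dec_elim in Hn as (v & Hv & Hd).
    pose proof (@small_vertices _ _ _ Hck Hv V1). pose proof (@small_vertices _ _ _ Hck Hv V2).
    pose proof (dist_tri M (gm i0) v (fst t)). pose proof (dist_tri M (gm i0) v (snd t)).
    lia. }
  set (onG := fun e : X * X => dec (exists j, j < L /\ same_edge e (geodesic_edge gm j))).
  set (gk := filter onG zk). set (ek := filter (fun e => negb (onG e)) zk).
  set (shell := filter (fun t => near (k + s) t && negb (near k t)) c).
  (* The boundaries of the near and the far part add up to the whole cycle. An edge of [zk] off the
     geodesic is too close to [gm i0] to belong to [z'], so it is an edge of a far triangle, which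
     lies in the shell. *)
  assert (Hek : length ek <= 3 * length shell).
  { rewrite <- length_bd. eapply reduced_length with (E := @same_edge X).
    - apply same_edge_sym.
    - apply same_edge_trans.
    - apply reduced_filter. exact Zred.
    - intros t Ht. apply filter_In in Ht as [Ht Hn].
      destruct (@reduced_in _ (@same_edge X) (@degenerate_edge X))
        with (l := zk) (m := (geodesic_edges gm 0 L ++ z') ++ bd cn) (t := t)
        as (u & Hu & Etu); auto using same_edge_refl, same_edge_sym.
      + apply same_edge_trans.
      + apply same_edge_degenerate.
      + intros g Hg. apply admissible_cochain1 in Hg.
        rewrite (Zg g Hg), xsum_app, <- (Hfill Hg), xsum_bd.
        rewrite (xsum_filter (d1 g) (near k) c). fold ck cn.
        destruct (xsum (d1 g) ck), (xsum (d1 g) cn); reflexivity.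
      + destruct (Zv t Ht) as [V1 V2].
        assert (V3 : d (gm i0) (fst u) <= k + s).
        { destruct Etu as [[E1 E2]|[E1 E2]]; congruence. }
        rewrite !in_app_iff in Hu. destruct Hu as [[Hu|Hu]|Hu].
        * exfalso. apply in_map_iff in Hu as (j & <- & Hj). apply in_seq in Hj.
          unfold onG in Hn. rewrite dec_intro in Hn; [discriminate|].
          exists j. split; [lia|exact Etu].
        * specialize (Hfar u Hu). lia.
        * exists u. split; [|exact Etu].
          unfold bd in *. rewrite in_flat_map in *. destruct Hu as (T & HT & Hu).
          exists T. split; [|exact Hu].
          apply filter_In in HT as [HT HTn]. apply filter_In. split; [exact HT|].
          rewrite HTn, andb_true_r. apply dec_intro. exists (fst u).
          split; [|exact V3]. destruct T as [[a b] f]. simpl in Hu.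
          intuition subst; simpl; auto. }
  assert (Hgk : length gk <= s * length ek).
  { set (pi := d (gm 0)).
    set (h := fun e : X * X => Nat.min (pi (fst e)) (pi (snd e))).
    rewrite <- (length_flat_map_seq h s ek), <- (length_map (geodesic_edge gm)).
    eapply reduced_length with (E := @same_edge X).
    - apply same_edge_sym.
    - apply same_edge_trans.
    - apply reduced_filter. exact Zred.
    - intros t Ht. apply filter_In in Ht as [Ht Hn].
      apply dec_elim in Hn as (j & Hj & Etj).
      exists (geodesic_edge gm j). split; [|exact Etj]. apply in_map.
      apply NNPP. intros Hno.
      assert (Hpi : forall i, i <= L -> pi (gm i) = i).
      { intros i Hi. unfold pi. rewrite Hgm; lia. }
      (* Cut the space at height [j] of [pi]. The cycle [zk] crosses the cut an even number of
         times, and [j] is the only geodesic edge that crosses it, so an edge of [ek] crosses too.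
         The heights of its ends differ by at most [s], so [seq (h e) s] contains [j]. *)
      set (g := fun x => pi x <=? j).
      assert (Hg : xsum (d0 g) zk = xsum (class_of (@same_edge X) t) zk).
      { apply xsum_ext. intros e He. destruct (onG e) eqn:Eo.
        - apply dec_elim in Eo as (j' & Hj' & Ee).
          rewrite (proj1 (cochain1_admissible (d0_cochain1 g)) _ _ Ee).
          unfold d0, g. simpl. rewrite !Hpi by lia.
          destruct (Nat.eq_dec j' j) as [->|Hne].
          + unfold class_of. rewrite dec_intro.
            * rewrite Nat.leb_refl. rewrite (proj2 (Nat.leb_gt (S j) j)); [reflexivity|lia].
            * eapply same_edge_trans; [exact Etj|]. now apply same_edge_sym.
          + unfold class_of. rewrite dec_intro_not.
            * destruct (Nat.leb_spec j' j), (Nat.leb_spec (S j') j); simpl; auto; lia.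
            * intros HE. apply Hne. apply (@geodesic_edge_inj gm L); auto.
              eapply same_edge_trans; [apply same_edge_sym; exact Ee|].
              eapply same_edge_trans; [apply same_edge_sym; exact HE|exact Etj].
        - unfold class_of. rewrite dec_intro_not.
          + assert (Hcv : ~ In j (seq (h e) s)).
            { intros Hjs. apply Hno. apply in_flat_map. exists e. split; [|exact Hjs].
              apply filter_In. rewrite Eo. auto. }
            rewrite in_seq in Hcv. unfold h in Hcv.
            rewrite Forall_forall in Zcl. specialize (Zcl e He). unfold close in Zcl.
            pose proof (dist_tri M (gm 0) (fst e) (snd e)) as T1.
            pose proof (dist_tri M (gm 0) (snd e) (fst e)) as T2.
            rewrite (dist_sym M (snd e) (fst e)) in T2. fold pi in T1, T2.
            change (d (gm 0)) with pi in T1, T2.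
            unfold d0, g.
            destruct (Nat.leb_spec (pi (fst e)) j), (Nat.leb_spec (pi (snd e)) j);
              simpl; auto; exfalso; apply Hcv; lia.
          + intros HE. apply dec_elim_not in Eo. apply Eo. exists j. split; [exact Hj|].
            eapply same_edge_trans; [apply same_edge_sym; exact HE|exact Etj]. }
      rewrite Zcyc, (@xsum_class_of _ _ (@degenerate_edge X)) in Hg;
        auto using same_edge_refl, same_edge_sym. discriminate. }
  assert (Hlen : length zk = length gk + length ek).
  { symmetry. apply filter_length. }
  assert (Hsh : ball_area (k + s) = ball_area k + length shell).
  { unfold ball_area. apply filter_length_diff. intros t. apply near_mono. lia. }
  assert (ball_area k <= 3 * K * (1 + s) * length shell) by nia.
  rewrite Hsh. unfold kappa. nia.
Qed.

(** Each of the [j] shells has at least a fraction [1 / kappa] of the area of the initial ball. With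
    [j = kappa] the area doubles, and iterating this gives exponential growth. *)
Lemma ball_area_linear k j :
  k + j * s <= D -> (kappa + j) * ball_area k <= kappa * ball_area (k + j * s).
Proof.
  induction j as [|j IH]; intros HD; simpl.
  - rewrite !Nat.add_0_r. lia.
  - simpl in HD.
    pose proof (IH ltac:(lia)). pose proof (@ball_area_step (k + j * s) ltac:(lia)).
    pose proof (@ball_area_mono k (k + j * s) ltac:(lia)).
    replace (k + (s + j * s)) with (k + j * s + s) by lia. nia.
Qed.

Lemma ball_area_exponential q :
  1 <= D -> q * (kappa * s) <= D -> 2 ^ q <= ball_area (q * (kappa * s)).
Proof.
  intros HD. induction q as [|q IH]; intros Hq.
  - simpl. now apply ball_area_pos.
  - simpl in Hq. pose proof (IH ltac:(lia)).
    pose proof (@ball_area_linear (q * (kappa * s)) kappa ltac:(lia)) as HL.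
    replace (S q * (kappa * s)) with (q * (kappa * s) + kappa * s) by lia.
    rewrite Nat.pow_succ_r'. unfold kappa in *. nia.
Qed.
End Ball.

Lemma geodesic_edges_close gm L a n :
  geodesic gm L -> a + n <= L -> Forall (close d 1) (geodesic_edges gm a n).
Proof.
  intros Hg Hn. apply Forall_map, Forall_forall. intros i Hi. apply in_seq in Hi.
  unfold close. simpl. rewrite (Hg i (S i)); lia.
Qed.

(** A minimal filling is at most linear in the length of the cycle, yet its ball about [gm i0]
    already contains [2 ^ q] triangles. *)
Lemma exponential_divergence gm L i0 z' q :
  geodesic gm L -> i0 < L -> Forall (close d 1) z' ->
  is_cycle (geodesic_edges gm 0 L ++ z') ->
  (forall e, In e z' -> q * (kappa * s) + 1 < d (gm i0) (fst e)) ->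
  2 ^ q <= K * (L + length z').
Proof.
  intros Hg Hi Hz Hcyc Hfar.
  set (z := geodesic_edges gm 0 L ++ z').
  destruct (@iso z) as (c0 & C1 & C2 & C3); auto.
  { eapply Forall_impl; [intros e; apply close_mono; exact Hs|].
    apply Forall_app. split; [eapply geodesic_edges_close; eauto|exact Hz]. }
  destruct (@least_nat (fun n => exists c, length c = n /\ Forall (small d s) c /\ fills c z))
    as (n & (c & Hn & D1 & D2) & Hmin); [eauto|].
  pose proof (Hmin _ (ex_intro _ c0 (conj eq_refl (conj C1 C3)))).
  assert (HE : 2 ^ q <= ball_area gm i0 c (q * (kappa * s))).
  { apply ball_area_exponential with (L := L) (z' := z') (D := q * (kappa * s) + 1);
      auto; try lia.
    intros c' H1 H2. rewrite Hn. apply Hmin. eauto. }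
  assert (ball_area gm i0 c (q * (kappa * s)) <= length c) by apply filter_length_le.
  unfold z in C2. rewrite length_app in C2.
  unfold geodesic_edges in C2. rewrite length_map, length_seq in C2. lia.
Qed.

End Divergence.

(** * Slim triangles and the four-point condition *)

Lemma exp_dominates_linear T C :
  1 <= T -> exists D0, forall D, D0 < D -> exists q, q * T + 1 < D /\ C * D < 2 ^ q.
Proof.
  intros HT.
  assert (Hexp : forall A B, exists Q, forall q, Q <= q -> A * q + B < 2 ^ q).
  { intros A B. set (n := 2 * A + B). exists (2 * n).
    assert (Hn : n < 2 ^ n) by (apply Nat.pow_gt_lin_r; lia).
    assert (HQ : A * (2 * n) + B < 2 ^ (2 * n) /\ A <= 2 ^ (2 * n)).
    { replace (2 * n) with (n + n) by lia. rewrite Nat.pow_add_r. unfold n in *. nia. }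
    intros q Hq. induction Hq as [|q Hq IH]; [tauto|].
    assert (2 ^ (2 * n) <= 2 ^ q) by (apply Nat.pow_le_mono_r; lia).
    rewrite Nat.pow_succ_r'. lia. }
  (* With [q] equal to [(D - 2) / T], [D] is less than [T * q + T + 2]. *)
  destruct (Hexp (C * T) (C * (T + 2))) as [Q HQ].
  exists (T * Q + 2). intros D HD.
  exists ((D - 2) / T).
  pose proof (Nat.div_mod_eq (D - 2) T). pose proof (Nat.mod_upper_bound (D - 2) T).
  specialize (HQ ((D - 2) / T)).
  assert (Q <= (D - 2) / T) by (apply Nat.div_le_lower_bound; lia).
  split; nia.
Qed.

Section Segments.
Variables (X : Type) (d : X -> X -> nat).
Hypothesis M : geodesic_metric d.

(** Only the point set is kept, not the parametrization, so that a side of a triangle can be read in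
    both directions. *)
Definition segment (P : X -> Prop) (x y : X) : Prop :=
  exists gm, gm 0 = x /\ gm (d x y) = y /\ geodesic d gm (d x y) /\
    forall p, P p <-> exists i, i <= d x y /\ p = gm i.

Lemma geodesic_exists x y :
  exists gm, gm 0 = x /\ gm (d x y) = y /\ geodesic d gm (d x y).
Proof.
  remember (d x y) as n eqn:E. symmetry in E. revert x E.
  induction n as [|n IH]; intros x E.
  - exists (fun _ => x). split; [reflexivity|]. split; [exact (dist_eq M _ _ E)|].
    intros i j _ Hj. rewrite (dist_refl M). lia.
  - destruct (dist_step M _ _ E) as (z & Hz & Hn).
    destruct (IH z Hn) as (gm & G1 & G2 & G3).
    exists (fun i => match i with 0 => x | S i => gm i end).
    split; [reflexivity|]. split; [exact G2|].
    intros [|i] [|j] Hij Hj; try lia.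
    + now rewrite (dist_refl M).
    + pose proof (dist_tri M x z (gm j)). pose proof (dist_tri M x (gm j) y).
      rewrite <- G1 in H at 2. rewrite (G3 0 j) in H by lia.
      rewrite <- G2 in H0 at 2. rewrite (G3 j n) in H0 by lia. lia.
    + rewrite G3; lia.
Qed.

Lemma segment_exists x y : exists P, segment P x y.
Proof.
  destruct (geodesic_exists x y) as (gm & G1 & G2 & G3).
  exists (fun p => exists i, i <= d x y /\ p = gm i), gm.
  repeat split; auto.
Qed.

Lemma segment_sym P x y : segment P x y -> segment P y x.
Proof.
  intros (gm & G1 & G2 & G3 & G4). exists (fun i => gm (d x y - i)).
  rewrite (dist_sym M y x). split; [now rewrite Nat.sub_0_r|].
  split; [now rewrite Nat.sub_diag|]. split.
  - intros i j Hij Hj. rewrite (dist_sym M), G3; lia.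
  - intros p. rewrite G4. split; intros (i & Hi & ->); exists (d x y - i).
    + split; [lia|]. f_equal. lia.
    + split; [lia|reflexivity].
Qed.

Lemma segment_left {P x y} : segment P x y -> P x.
Proof. intros (gm & G1 & G2 & G3 & G4). apply G4. exists 0. split; [lia|auto]. Qed.

Lemma segment_right {P x y} : segment P x y -> P y.
Proof. intros H. apply segment_sym in H. eapply segment_left; eauto. Qed.

Lemma segment_dist {P x y p} : segment P x y -> P p -> d x p + d p y = d x y.
Proof.
  intros (gm & G1 & G2 & G3 & G4) Hp. apply G4 in Hp as (i & Hi & ->).
  rewrite <- G1 at 1. rewrite (G3 0 i) by lia. rewrite <- G2 at 1. rewrite G3; lia.
Qed.

Lemma segment_point P x y i : segment P x y -> i <= d x y -> exists p, P p /\ d x p = i.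
Proof.
  intros (gm & G1 & G2 & G3 & G4) Hi. exists (gm i). split; [apply G4; eauto|].
  rewrite <- G1. rewrite G3; lia.
Qed.

Lemma segment_pair {P x y p q} :
  segment P x y -> P p -> P q -> d x p <= d x q -> d p q = d x q - d x p.
Proof.
  intros (gm & G1 & G2 & G3 & G4) Hp Hq.
  apply G4 in Hp as (i & Hi & ->). apply G4 in Hq as (j & Hj & ->).
  rewrite <- G1. rewrite (G3 0 i), (G3 0 j) by lia. intros. rewrite G3; lia.
Qed.

Lemma segment_path_increasing {P x y p q} :
  segment P x y -> P p -> P q -> d x p <= d x q ->
  exists l, lst p l = q /\ length l = d p q /\ Forall (close d 1) (edges p l) /\
    forall v, In v (p :: l) -> P v.
Proof.
  intros (gm & G1 & G2 & G3 & G4) Hp Hq.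
  apply G4 in Hp as (i & Hi & ->). apply G4 in Hq as (j & Hj & ->).
  rewrite <- G1. rewrite (G3 0 i), (G3 0 j) by lia. intros Hij.
  rewrite (G3 i j) by lia.
  exists (map gm (seq (S i) (j - i))).
  rewrite length_map, length_seq, lst_map, edges_map.
  assert (Hl : forall n a, lst a (seq (S a) n) = a + n).
  { induction n as [|n IH]; intros a; simpl; [lia|]. rewrite IH. lia. }
  split; [f_equal; rewrite Hl; lia|]. split; [reflexivity|]. split.
  - apply Forall_map, Forall_forall. intros [a b] Hab. unfold close. simpl.
    assert (Hb : forall n k, In (a, b) (edges k (seq (S k) n)) -> b = S a /\ k <= a < k + n).
    { induction n as [|n IH]; intros k; simpl; [tauto|].
      intros [E|H]; [injection E as <- <-; lia|]. specialize (IH _ H). lia. }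
    destruct (Hb _ _ Hab) as [-> Ha]. rewrite G3; lia.
  - intros v Hv. apply G4. destruct Hv as [<-|Hv]; [exists i; split; [lia|auto]|].
    apply in_map_iff in Hv as (k & <- & Hk). apply in_seq in Hk. exists k. split; [lia|auto].
Qed.

Lemma segment_path {P x y p q} :
  segment P x y -> P p -> P q ->
  exists l, lst p l = q /\ length l = d p q /\ Forall (close d 1) (edges p l) /\
    forall v, In v (p :: l) -> P v.
Proof.
  intros HS Hp Hq. destruct (le_lt_dec (d x p) (d x q)) as [H|H].
  - eapply segment_path_increasing; eauto.
  - pose proof (segment_dist HS Hp). pose proof (segment_dist HS Hq).
    eapply segment_path_increasing; [apply segment_sym; exact HS|..]; auto.
    rewrite !(dist_sym M y). lia.
Qed.

(** * Slim triangles imply the four-point condition *)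

Definition slim (delta : nat) : Prop :=
  forall x y z A B C, segment A x y -> segment B x z -> segment C y z ->
    forall p, A p -> exists q, (B q \/ C q) /\ d p q <= delta.

(** Let [m] be the point of [P] closest to [x] among those within [delta] of the side from [y] to
    [w]. Its predecessor must be near the side from [x] to [w], so [m] is near both sides, and
    [d w m] exceeds the Gromov product of [x] and [y] at [w] by a bounded amount. *)
Lemma slim_insize delta x y w P :
  slim delta -> segment P x y ->
  exists m, P m /\ 2 * d w m + d x y <= d x w + d y w + 4 * delta + 2.
Proof.
  intros Hsl HP.
  destruct (segment_exists x w) as [B HB]. destruct (segment_exists y w) as [C HC].
  destruct (@least_nat (fun i => exists p c, P p /\ d x p = i /\ C c /\ d p c <= delta))
    as (i & (m & c & Hm & Hi & Hc & Hmc) & Hmin).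
  { exists (d x y), y, y. rewrite (dist_refl M).
    repeat split; [eapply segment_right; eauto|eapply segment_left; eauto|lia]. }
  assert (Hb : exists b, B b /\ d m b <= delta + 1).
  { destruct i as [|i].
    - exists m. apply (dist_eq M) in Hi. subst m. rewrite (dist_refl M).
      split; [eapply segment_left; eauto|lia].
    - pose proof (segment_dist HP Hm).
      destruct (@segment_point P x y i HP) as (p & Hp & Hpi); [lia|].
      destruct (Hsl _ _ _ _ _ _ HP HB HC p Hp) as (q & [Hq|Hq] & Hd).
      + exists q. split; [exact Hq|].
        assert (d p m = 1) by (rewrite (segment_pair HP Hp Hm); lia).
        pose proof (dist_tri M m p q). rewrite (dist_sym M m p) in *. lia.
      + specialize (Hmin i). exfalso.
        assert (S i <= i); [|lia]. apply Hmin. exists p, q. auto. }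
  destruct Hb as (b & Hb & Hmb).
  exists m. split; [exact Hm|].
  pose proof (segment_dist HP Hm). pose proof (segment_dist HB Hb).
  pose proof (segment_dist HC Hc).
  pose proof (dist_tri M x b m). pose proof (dist_tri M m b w).
  pose proof (dist_tri M y c m). pose proof (dist_tri M m c w).
  pose proof (dist_sym M b m). pose proof (dist_sym M c m).
  pose proof (dist_sym M m w). pose proof (dist_sym M m y). lia.
Qed.

(** The point [m] of [slim_insize] has some [q] within [delta] on one of the other two sides. Going
    through [q] bounds [d x w + d z w] or [d y w + d z w]; the errors add up to [6 * delta + 2]. *)
Lemma slim_hyperbolic delta : slim delta -> hyperbolic_metric d (3 * delta + 1).
Proof.
  intros Hsl x y z w.
  destruct (segment_exists x y) as [A HA]. destruct (segment_exists x z) as [B HB].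
  destruct (segment_exists y z) as [C HC].
  destruct (@slim_insize delta x y w A Hsl HA) as (m & Hm & Hins).
  destruct (Hsl _ _ _ _ _ _ HA HB HC m Hm) as (q & Hq & Hd).
  pose proof (dist_tri M w m q).
  pose proof (dist_tri M x q w). pose proof (dist_tri M y q w). pose proof (dist_tri M z q w).
  pose proof (dist_sym M q w). pose proof (dist_sym M q z).
  destruct Hq as [Hq|Hq].
  - pose proof (segment_dist HB Hq). lia.
  - pose proof (segment_dist HC Hq). lia.
Qed.

(** * Detours around a point of a side *)

Definition detour (m : X) (D : nat) (a b : X) (n : nat) : Prop :=
  exists l, lst a l = b /\ length l <= n /\ Forall (close d 1) (edges a l) /\
    forall v, In v (a :: l) -> D <= d m v.

Lemma detour_trans m D a b e n n' :
  detour m D a b n -> detour m D b e n' -> detour m D a e (n + n').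
Proof.
  intros (l & L1 & L2 & L3 & L4) (l' & L1' & L2' & L3' & L4').
  exists (l ++ l'). rewrite lst_app, L1, length_app, edges_app, L1, Forall_app.
  split; [exact L1'|]. split; [lia|]. split; [auto|].
  intros v [<-|Hv]; [apply L4; now left|].
  apply in_app_iff in Hv as [Hv|Hv]; [apply L4|apply L4']; now right.
Qed.

Lemma detour_segment {m D P x y a b n} :
  segment P x y -> P a -> P b -> (forall v, P v -> D <= d m v) -> d a b <= n ->
  detour m D a b n.
Proof.
  intros HP Ha Hb Hf Hn. destruct (segment_path HP Ha Hb) as (l & L1 & L2 & L3 & L4).
  exists l. repeat split; auto. lia.
Qed.

Lemma detour_far m D a b :
  d a b <= D -> 2 * D <= d m a \/ 2 * D <= d m b -> detour m D a b D.
Proof.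
  intros Hab Hf. destruct (segment_exists a b) as [P HP].
  apply (detour_segment HP); auto.
  - eapply segment_left; eauto.
  - eapply segment_right; eauto.
  - intros v Hv. pose proof (segment_dist HP Hv).
    pose proof (dist_tri M m v a). pose proof (dist_tri M m v b).
    pose proof (dist_sym M v a). lia.
Qed.

(* [m] is a point of [A] at distance [D] from the other two sides. Points of
   [A] about [2D] before and after [m] project to the other sides, and the two
   projections are joined within those sides, directly or after going [10D]
   along [B], by a path whose length is linear in [D]. *)
Lemma triangle_detour {x y z A B C m D} :
  segment A x y -> segment B x z -> segment C y z -> A m ->
  (forall v, B v \/ C v -> D <= d m v) ->
  (forall p, A p -> exists q, (B q \/ C q) /\ d p q <= D) ->
  (forall p, B p -> exists q, (A q \/ C q) /\ d p q <= D) ->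
  exists a b, A a /\ A b /\ d x a <= d x m /\ d x m <= d x b /\ detour m D a b (30 * D).
Proof.
  intros HA HB HC Hm Hfar nearA nearB.
  pose proof (dist_sym M) as ds. pose proof (dist_tri M) as dt.
  assert (fB : forall v, B v -> D <= d m v) by auto.
  assert (fC : forall v, C v -> D <= d m v) by auto.
  pose proof (segment_dist HA Hm) as Em.
  assert (Hmono : forall a b n n', n <= n' -> detour m D a b n -> detour m D a b n').
  { intros a b n n' Hn (l & L1 & L2 & L3 & L4). exists l. repeat split; auto. lia. }
  assert (Hx : exists x' x'', A x' /\ d x x' <= d x m /\ d x m <= d x x' + 2 * D /\
     (B x'' \/ C x'') /\ d x' x'' <= D /\ detour m D x' x'' D).
  { destruct (le_lt_dec (2 * D) (d x m)) as [H|H].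
    - destruct (@segment_point A x y (d x m - 2 * D) HA) as (x' & Hx' & Ex'); [lia|].
      destruct (nearA x' Hx') as (x'' & Hx'' & Dx).
      exists x', x''. repeat split; auto; try lia. apply detour_far; auto.
      left. rewrite ds, (segment_pair HA Hx' Hm); lia.
    - exists x, x. pose proof (segment_left HA). pose proof (segment_left HB).
      rewrite (dist_refl M). repeat split; auto; try lia.
      apply (detour_segment HB); auto. rewrite (dist_refl M). lia. }
  assert (Hy : exists y' y'', A y' /\ d x m <= d x y' /\ d x y' <= d x m + 2 * D /\
     (B y'' \/ C y'') /\ d y' y'' <= D /\ detour m D y'' y' D).
  { destruct (le_lt_dec (d x m + 2 * D) (d x y)) as [H|H].
    - destruct (@segment_point A x y (d x m + 2 * D) HA) as (y' & Hy' & Ey'); [lia|].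
      destruct (nearA y' Hy') as (y'' & Hy'' & Dy).
      exists y', y''. repeat split; auto; try lia. apply detour_far.
      + now rewrite ds.
      + right. rewrite (segment_pair HA Hm Hy'); lia.
    - exists y, y. pose proof (segment_right HA). pose proof (segment_left HC).
      rewrite (dist_refl M). repeat split; auto; try lia.
      apply (detour_segment HC); auto. rewrite (dist_refl M). lia. }
  destruct Hx as (x' & x'' & Ax' & X1 & X2 & Sx & Dx & Px).
  destruct Hy as (y' & y'' & Ay' & Y1 & Y2 & Sy & Dy & Py).
  assert (Exm : d x' m <= 2 * D) by (rewrite (segment_pair HA Ax' Hm); lia).
  assert (Emy : d m y' <= 2 * D) by (rewrite (segment_pair HA Hm Ay'); lia).
  assert (Exy : d x'' y'' <= 6 * D).
  { pose proof (dt x'' x' y''). pose proof (dt x' m y''). pose proof (dt m y' y'').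
    pose proof (ds x'' x'). lia. }
  destruct Sx as [Bx|Cx], Sy as [By|Cy].
  - exists x', y'. repeat split; auto. apply Hmono with (n := D + (6 * D + D)); [lia|].
    apply detour_trans with x''; auto. apply detour_trans with y''; auto.
    apply (detour_segment HB); auto.
  - pose proof (segment_dist HB Bx) as Ex.
    destruct (le_lt_dec (d x'' z) (10 * D)) as [H|H].
    + exists x', y'. repeat split; auto. apply Hmono with (n := D + (10 * D + (16 * D + D))); [lia|].
      apply detour_trans with x''; auto. apply detour_trans with z.
      { apply (detour_segment HB); auto. eapply segment_right; eauto. }
      apply detour_trans with y''; auto. apply (detour_segment HC); auto.
      * eapply segment_right; eauto.
      * pose proof (dt z x'' y''). pose proof (ds z x''). lia.
    (* As [x''] is within [3 * D] of [m], the point [w] is at least [7 * D] from [m]. If it projects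
       to [A], it does so beyond [m], where the projection can replace [y']. *)
    + destruct (@segment_point B x z (d x x'' + 10 * D) HB) as (w & Bw & Ew); [lia|].
      assert (Exw : d x'' w = 10 * D) by (rewrite (segment_pair HB Bx Bw); lia).
      assert (Emw : 7 * D <= d m w).
      { pose proof (dt x'' x' m). pose proof (dt x'' m w). pose proof (ds x'' x'). lia. }
      destruct (nearB w Bw) as (w' & [Aw|Cw] & Dw).
      * exists x', w'. repeat split; auto.
        { pose proof (dt x x'' x'). pose proof (dt x w' w). pose proof (ds x'' x').
          pose proof (ds w' w). lia. }
        apply Hmono with (n := D + (10 * D + D)); [lia|].
        apply detour_trans with x''; auto. apply detour_trans with w.
        { apply (detour_segment HB); auto. lia. }
        apply detour_far; auto. lia.
      * exists x', y'. repeat split; auto.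
        apply Hmono with (n := D + (10 * D + (D + (17 * D + D)))); [lia|].
        apply detour_trans with x''; auto. apply detour_trans with w.
        { apply (detour_segment HB); auto. lia. }
        apply detour_trans with w'. { apply detour_far; auto. lia. }
        apply detour_trans with y''; auto. apply (detour_segment HC); auto.
        pose proof (dt w' w y''). pose proof (dt w x'' y'').
        pose proof (ds w' w). pose proof (ds w x''). lia.
  - destruct (le_lt_dec (d x y'') (10 * D)) as [H|H].
    + exists x, y'. pose proof (segment_left HA). rewrite (dist_refl M).
      repeat split; auto; try lia.
      apply Hmono with (n := 10 * D + D); [lia|]. apply detour_trans with y''; auto.
      apply (detour_segment HB); auto. eapply segment_left; eauto.
    + pose proof (segment_dist HB By) as Ey.
      destruct (@segment_point B x z (d x y'' - 10 * D) HB) as (v & Bv & Ev); [lia|].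
      assert (Evy : d v y'' = 10 * D) by (rewrite (segment_pair HB Bv By); lia).
      assert (Evm : d x v + 7 * D <= d x m) by (pose proof (dt x y' y''); lia).
      assert (Emv : 7 * D <= d m v) by (pose proof (dt x v m); pose proof (ds v m); lia).
      destruct (nearB v Bv) as (v' & Sv & Dv).
      assert (Pv : detour m D v' v D) by (apply detour_far; [rewrite ds; auto|lia]).
      assert (Pvy : detour m D v y'' (10 * D)) by (apply (detour_segment HB); auto; lia).
      destruct Sv as [Av|Cv].
      * exists v', y'. repeat split; auto.
        { pose proof (dt x v v'). lia. }
        apply Hmono with (n := D + (10 * D + D)); [lia|].
        apply detour_trans with v; auto. apply detour_trans with y''; auto.
      * exists x', y'. repeat split; auto.
        apply Hmono with (n := D + (17 * D + (D + (10 * D + D)))); [lia|].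
        apply detour_trans with x''; auto. apply detour_trans with v'.
        { apply (detour_segment HC); auto.
          pose proof (dt x'' y'' v'). pose proof (dt y'' v v').
          pose proof (ds y'' v). lia. }
        apply detour_trans with v; auto. apply detour_trans with y''; auto.
  - exists x', y'. repeat split; auto. apply Hmono with (n := D + (6 * D + D)); [lia|].
    apply detour_trans with x''; auto. apply detour_trans with y''; auto.
    apply (detour_segment HC); auto.
Qed.

(** * Slim triangles from linear fillings *)

Variables K s : nat.
Hypothesis Hs : 1 <= s.
Hypothesis iso : forall z, Forall (close d s) z -> is_cycle z -> fillable d (K * length z) s z.

(** The detour and the piece of [A] that it bypasses form a cycle of at most [2 * n] edges, since
    the geodesic piece is no longer than the detour. *)
Lemma detour_length {x y A m D a b n} q :
  segment A x y -> A m -> A a -> A b -> d x a <= d x m -> d x m <= d x b ->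
  detour m D a b n -> q * ((3 * K * (1 + s) + 1) * s) + 1 < D ->
  2 ^ q <= K * (2 * n).
Proof.
  intros HA Hm Ha Hb H1 H2 (l & L1 & L2 & L3 & L4) HD.
  pose proof (path_dist M L3 (lst_in a l)) as Hab. rewrite L1 in Hab.
  (* The endpoint [b] lies on the detour, hence away from [m], so an edge of the piece starts at
     [m]. *)
  pose proof (L4 b ltac:(rewrite <- L1; apply lst_in)) as Hmb.
  rewrite (segment_pair HA Hm Hb H2) in Hmb.
  destruct HA as (gm & G1 & G2 & G3 & G4).
  apply G4 in Hm as (i0 & Hi0 & Em). apply G4 in Ha as (i & Hi & Ea).
  apply G4 in Hb as (j & Hj & Eb). subst m a b.
  rewrite <- G1 in H1, H2, Hmb. rewrite !(G3 0) in H1, H2, Hmb by lia.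
  rewrite !Nat.sub_0_r in *.
  rewrite (G3 i j) in Hab by lia.
  apply Nat.le_trans with (K * ((j - i) + length (edges (gm i) l))).
  2:{ rewrite length_edges. nia. }
  apply (@exponential_divergence X d M K s Hs iso (fun k => gm (i + k)) (j - i) (i0 - i)).
  - intros p r Hpr Hr. rewrite G3; lia.
  - lia.
  - exact L3.
  - intros g. rewrite xsum_app, xsum_d0_geodesic_edges, xsum_d0_edges, L1.
    rewrite Nat.add_0_l, Nat.add_0_r. replace (i + (j - i)) with j by lia.
    destruct (g (gm i)), (g (gm j)); reflexivity.
  - intros e He. replace (i + (i0 - i)) with i0 by lia.
    apply in_edges in He as [He _]. specialize (L4 _ He). lia.
Qed.

(** Take the least [D] such that each side is in the [D]-neighbourhood of the other two. Unless [D]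
    is zero, some side has a point at distance at least [D] from the others, and a detour of length
    [30 * D] gives [2 ^ q <= 60 * K * D], which is impossible for large [D]. *)
Lemma linear_filling_slim : exists delta, slim delta.
Proof.
  destruct (@exp_dominates_linear ((3 * K * (1 + s) + 1) * s) (60 * K)) as [D0 HD0]; [nia|].
  exists D0. intros x y z A B C HA HB HC.
  assert (core : forall x y z A B C m D,
    segment A x y -> segment B x z -> segment C y z -> A m ->
    (forall v, B v \/ C v -> D <= d m v) ->
    (forall p, A p -> exists q, (B q \/ C q) /\ d p q <= D) ->
    (forall p, B p -> exists q, (A q \/ C q) /\ d p q <= D) -> D <= D0).
  { clear x y z A B C HA HB HC. intros x y z A B C m D HA HB HC Hm Hf nA nB.
    destruct (le_lt_dec D D0) as [|Hlt]; [assumption|exfalso].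
    destruct (HD0 D Hlt) as (q & Hq1 & Hq2).
    destruct (triangle_detour HA HB HC Hm Hf nA nB) as (a & b & Ha & Hb & H1 & H2 & Hdt).
    pose proof (detour_length q HA Hm Ha Hb H1 H2 Hdt Hq1). nia. }
  pose (near := fun (P Q R : X -> Prop) D =>
    forall p, P p -> exists q, (Q q \/ R q) /\ d p q <= D).
  destruct (@least_nat (fun D => near A B C D /\ near B A C D /\ near C A B D))
    as (D & (nA & nB & nC) & Hmin).
  { exists (d x y + d x z + d y z). pose proof (dist_sym M) as ds.
    repeat split; intros p Hp.
    - exists x. split; [left; eapply segment_left; eauto|].
      pose proof (segment_dist HA Hp). rewrite ds. lia.
    - exists x. split; [left; eapply segment_left; eauto|].
      pose proof (segment_dist HB Hp). rewrite ds. lia.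
    - exists y. split; [left; eapply segment_right; eauto|].
      pose proof (segment_dist HC Hp). rewrite ds. lia. }
  assert (HD : D <= D0).
  { destruct D as [|D]; [lia|].
    assert (Hnot : ~ (near A B C D /\ near B A C D /\ near C A B D)).
    { intros H. specialize (Hmin _ H). lia. }
    assert (Hfail : forall P Q R, ~ near P Q R D ->
      exists m, P m /\ forall v, Q v \/ R v -> S D <= d m v).
    { intros P Q R HN. apply not_all_ex_not in HN as [m Hm].
      apply imply_to_and in Hm as [Pm Hm]. exists m. split; [exact Pm|].
      intros v Hv. destruct (le_lt_dec (d m v) D); [exfalso; eauto|lia]. }
    apply not_and_or in Hnot as [H|H]; [|apply not_and_or in H as [H|H]].
    - apply Hfail in H as (m & Hm & Hf). exact (core x y z A B C m _ HA HB HC Hm Hf nA nB).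
    - apply Hfail in H as (m & Hm & Hf).
      exact (core x z y B A C m _ HB HA (segment_sym HC) Hm Hf nB nA).
    - apply Hfail in H as (m & Hm & Hf).
      apply (core y z x C A B m (S D)); auto using segment_sym.
      intros p Hp. destruct (nA p Hp) as (q & Hq & Hd). exists q. tauto. }
  intros p Hp. destruct (nA p Hp) as (q & Hq & Hd). exists q. split; [exact Hq|lia].
Qed.

Lemma linear_filling_hyperbolic : exists delta, hyperbolic_metric d delta.
Proof.
  destruct linear_filling_slim as [delta H]. exists (3 * delta + 1).
  now apply slim_hyperbolic.
Qed.

End Segments.

(** * Word metrics *)

Section WordMetric.
Variable G : Group.
Local Notation "x * y" := (gmul G x y).
Local Notation "/ x" := (ginv G x).
Local Notation "1" := (gone G).

Lemma gmul_inv_r x : x * / x = 1.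
Proof.
  rewrite <- (gone_mul G (x * / x)), <- (ginv_mul G (/ x)) at 1.
  rewrite <- (gassoc G (/ / x)), (gassoc G (/ x) x), ginv_mul, gone_mul. apply ginv_mul.
Qed.

Lemma gmul_one_r x : x * 1 = x.
Proof. now rewrite <- (ginv_mul G x), gassoc, gmul_inv_r, gone_mul. Qed.

Lemma gmul_cancel_l x y z : x * y = x * z -> y = z.
Proof.
  intros H. rewrite <- (gone_mul G y), <- (gone_mul G z), <- (ginv_mul G x).
  rewrite <- !gassoc. now rewrite H.
Qed.

Lemma gmul_inv_mul_l x y : x * (/ x * y) = y.
Proof. now rewrite gassoc, gmul_inv_r, gone_mul. Qed.

Lemma gmul_mul_inv_l x y : / x * (x * y) = y.
Proof. now rewrite gassoc, ginv_mul, gone_mul. Qed.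

Lemma ginv_unique x y : x * y = 1 -> y = / x.
Proof. intros H. apply (gmul_cancel_l x). now rewrite H, gmul_inv_r. Qed.

Lemma ginv_involutive x : / / x = x.
Proof. symmetry. apply ginv_unique, ginv_mul. Qed.

Lemma ginv_gmul x y : / (x * y) = / y * / x.
Proof.
  symmetry. apply ginv_unique.
  now rewrite <- gassoc, (gassoc G y), gmul_inv_r, gone_mul, gmul_inv_r.
Qed.

Lemma eval_app (u v : word G) : eval (u ++ v) = eval u * eval v.
Proof. induction u; simpl; [now rewrite gone_mul|]. now rewrite IHu, gassoc. Qed.

Lemma eval_inv_letter (a : letter G) : eval_letter (inv_letter a) = / eval_letter a.
Proof. destruct a as [[] x]; simpl; auto. unfold eval_letter. simpl. now rewrite ginv_involutive. Qed.

Lemma winv_cons (a : letter G) w : winv (a :: w) = winv w ++ [inv_letter a].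
Proof. reflexivity. Qed.

Lemma eval_winv (w : word G) : eval (winv w) = / eval w.
Proof.
  induction w as [|a w IH].
  - apply ginv_unique. apply gone_mul.
  - rewrite winv_cons, eval_app, IH. simpl. rewrite gmul_one_r, eval_inv_letter.
    now rewrite ginv_gmul.
Qed.

Lemma word_over_app S (u v : word G) : word_over S u -> word_over S v -> word_over S (u ++ v).
Proof. intros Hu Hv a Ha. apply in_app_iff in Ha as [Ha|Ha]; auto. Qed.

Lemma word_over_winv S (w : word G) : word_over S w -> word_over S (winv w).
Proof.
  intros H a Ha. unfold winv in Ha. rewrite <- in_rev in Ha.
  apply in_map_iff in Ha as (b & <- & Hb). exact (H b Hb).
Qed.

Lemma length_winv (w : word G) : length (winv w) = length w.
Proof. unfold winv. now rewrite length_rev, length_map. Qed.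

(** A total function chosen from [is_dist]; its value is meaningful only when [/ x * y] is a product
    of letters over [S]. *)
Definition wdist (S : list G) (x y : G) : nat := epsilon (inhabits 0) (is_dist G S x y).

Lemma wdist_spec S x y :
  (exists w, word_over S w /\ eval w = / x * y) -> is_dist G S x y (wdist S x y).
Proof.
  intros H. unfold wdist. apply epsilon_spec.
  destruct (@least_nat (fun n => exists w, word_over S w /\ length w = n /\ eval w = / x * y))
    as (n & Hn & Hmin).
  { destruct H as (w & H1 & H2). eauto. }
  exists n. split; [exact Hn|]. intros w H1 H2. apply Hmin. eauto.
Qed.

Lemma wdist_le S x y w : word_over S w -> eval w = / x * y -> wdist S x y <= length w.
Proof. intros H1 H2. apply (@wdist_spec S x y); eauto. Qed.

Lemma is_dist_wdist S x y n : is_dist G S x y n -> n = wdist S x y.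
Proof.
  intros [(w & H1 & H2 & H3) Hmin].
  destruct (@wdist_spec S x y) as [(w' & H1' & H2' & H3') Hmin']; [eauto|].
  specialize (Hmin _ H1' H3'). specialize (Hmin' _ H1 H3). lia.
Qed.

Lemma is_subgroup_full : is_subgroup G (full G).
Proof. repeat split. Qed.

Section Subgroup.
Variables (H : G -> Prop) (S : list G).
Hypothesis HH : is_subgroup G H.
Hypothesis HS : generates G H S.

Lemma subgroup_letter a : In (snd a) S -> H (eval_letter a).
Proof.
  intros Ha. apply HS in Ha. destruct a as [[] x]; simpl in *; auto. now apply HH.
Qed.

Lemma subgroup_wdist_spec x y : H x -> H y -> is_dist G S x y (wdist S x y).
Proof.
  intros Hx Hy. apply wdist_spec. apply HS. apply HH; [now apply HH|exact Hy].
Qed.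

(** Parametrizing [H] by a type [Y] lets one statement serve both [G] itself and the subtype [elt]
    of a subgroup. *)
Lemma wdist_geodesic (Y : Type) (i : Y -> G) :
  (forall p, H (i p)) -> (forall p q, i p = i q -> p = q) ->
  (forall h, H h -> exists p, i p = h) ->
  geodesic_metric (fun p q => wdist S (i p) (i q)).
Proof.
  intros Hi Hinj Hsurj.
  assert (spec : forall p q, is_dist G S (i p) (i q) (wdist S (i p) (i q)))
    by (intros; apply subgroup_wdist_spec; auto).
  assert (tri : forall x y z, wdist S (i x) (i z) <= wdist S (i x) (i y) + wdist S (i y) (i z)).
  { intros x y z. destruct (spec x y) as [(u & U1 & <- & U3) _].
    destruct (spec y z) as [(v & V1 & <- & V3) _].
    rewrite <- length_app. apply wdist_le; [now apply word_over_app|].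
    rewrite eval_app, U3, V3, <- gassoc. now rewrite gmul_inv_mul_l. }
  split.
  - intros x. assert (wdist S (i x) (i x) <= length (@nil (letter G))); [|simpl in *; lia].
    apply wdist_le; [intros a []|]. simpl. now rewrite ginv_mul.
  - intros x y E. destruct (spec x y) as [(u & U1 & U2 & U3) _].
    rewrite E in U2. destruct u; [|discriminate]. simpl in U3. apply Hinj.
    apply (gmul_cancel_l (/ i x)). now rewrite <- U3, ginv_mul.
  - assert (le : forall x y, wdist S (i x) (i y) <= wdist S (i y) (i x)).
    { intros x y. destruct (spec y x) as [(u & U1 & <- & U3) _].
      rewrite <- length_winv. apply wdist_le; [now apply word_over_winv|].
      now rewrite eval_winv, U3, ginv_gmul, ginv_involutive. }
    intros x y. apply Nat.le_antisymm; apply le.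
  - exact tri.
  - intros x y n E. destruct (spec x y) as [(u & U1 & U2 & U3) _].
    rewrite E in U2. destruct u as [|a u]; [discriminate|]. simpl in U2, U3.
    assert (Ha : In (snd a) S) by (apply U1; now left).
    destruct (Hsurj (i x * eval_letter a)) as [z Hz].
    { apply HH; [apply Hi|now apply subgroup_letter]. }
    exists z.
    assert (wdist S (i x) (i z) <= 1%nat).
    { change 1%nat with (length [a]). apply wdist_le.
      - intros b [<-|[]]. exact Ha.
      - simpl. now rewrite Hz, gmul_mul_inv_l, gmul_one_r. }
    assert (wdist S (i z) (i y) <= n).
    { injection U2 as <-. apply wdist_le; [intros b Hb; apply U1; now right|].
      now rewrite Hz, ginv_gmul, <- gassoc, <- U3, gmul_mul_inv_l. }
    specialize (tri x z y). lia.
Qed.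

End Subgroup.

Lemma finite_balls (S : list G) n :
  exists L, forall w, word_over S w -> length w <= n -> In (eval w) L.
Proof.
  induction n as [|n [L HL]].
  - exists [1]. intros w _ Hw. destruct w; [now left|simpl in Hw; lia].
  - exists (1 :: flat_map (fun u => flat_map (fun s => [s * u; / s * u]) S) L).
    intros [|[b s] w] Hw Hl; [now left|right].
    apply in_flat_map. exists (eval w). split.
    + apply HL; [intros a Ha; apply Hw; now right|simpl in Hl; lia].
    + apply in_flat_map. exists s. split; [exact (Hw (b, s) (or_introl eq_refl))|].
      destruct b; simpl; auto.
Qed.

(* Balls of a word metric are finite, so a word metric on a subgroup is
   bounded in terms of any other one. *)
Lemma wdist_comparison H (S1 S2 : list G) D :
  generates G H S2 ->
  exists N, forall x y w, H (/ x * y) -> word_over S1 w -> eval w = / x * y ->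
    length w <= D -> wdist S2 x y <= N.
Proof.
  intros HS. destruct (finite_balls S1 D) as [L HL].
  assert (HN : exists N, forall u, In u L -> H u ->
    exists v, word_over S2 v /\ eval v = u /\ length v <= N).
  { clear HL. induction L as [|u L [N IH]]; [exists 0; intros u []|].
    destruct (classic (H u)) as [Hu|Hu].
    - destruct (proj2 HS u Hu) as (v & V1 & V2). exists (N + length v).
      intros u' [<-|Hu'] Hh; [exists v; repeat split; auto; lia|].
      destruct (IH u' Hu' Hh) as (v' & V1' & V2' & V3'). exists v'. repeat split; auto; lia.
    - exists N. intros u' [<-|Hu'] Hh; [tauto|auto]. }
  destruct HN as [N HN]. exists N. intros x y w Hxy Hw Ew Lw.
  destruct (HN (/ x * y)) as (v & V1 & V2 & V3); auto.
  { rewrite <- Ew. auto. }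
  pose proof (@wdist_le S2 x y v V1 V2). lia.
Qed.

(** * Filling loops of a finitely presented subgroup *)

Section Presentation.
Variables (H : G -> Prop) (S : list G).
Hypothesis HH : is_subgroup G H.
Hypothesis HS : generates G H S.

Definition elt : Type := {h : G | H h}.
Definition val (p : elt) : G := proj1_sig p.

Lemma val_in p : H (val p).
Proof. exact (proj2_sig p). Qed.

Lemma val_inj p q : val p = val q -> p = q.
Proof. apply eq_sig_hprop. intros. apply proof_irrelevance. Qed.

Lemma elt_geodesic : geodesic_metric (fun p q => wdist S (val p) (val q)).
Proof.
  apply wdist_geodesic with (H := H); auto using val_in, val_inj.
  intros h Hh. now exists (exist H h Hh).
Qed.

(* Letters outside the generating set, which may occur in [in_ncl], act trivially. *)
Definition act (p : elt) (a : letter G) : elt :=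
  match excluded_middle_informative (In (snd a) S) with
  | left i => exist H (val p * eval_letter a)
                (proj1 (proj2 HH) _ _ (val_in p) (subgroup_letter HH HS a i))
  | right _ => p
  end.

Lemma val_act p a : In (snd a) S -> val (act p a) = val p * eval_letter a.
Proof. intros Ha. unfold act. destruct (excluded_middle_informative _); tauto || reflexivity. Qed.

Lemma act_inv p a : act (act p a) (inv_letter a) = p.
Proof.
  destruct (classic (In (snd a) S)) as [Ha|Ha].
  - apply val_inj. rewrite !val_act by auto.
    now rewrite eval_inv_letter, <- gassoc, gmul_inv_r, gmul_one_r.
  - unfold act. simpl. destruct (excluded_middle_informative _); tauto.
Qed.

Fixpoint wpath (p : elt) (w : word G) : list elt :=
  match w with
  | [] => []
  | a :: w' => act p a :: wpath (act p a) w'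
  end.
Definition wend (p : elt) (w : word G) : elt := lst p (wpath p w).

Lemma wpath_app p u v : wpath p (u ++ v) = wpath p u ++ wpath (wend p u) v.
Proof. revert p. induction u; intros; simpl; f_equal; auto. Qed.

Lemma wend_app p u v : wend p (u ++ v) = wend (wend p u) v.
Proof. unfold wend at 1. now rewrite wpath_app, lst_app. Qed.

Lemma length_wpath p w : length (wpath p w) = length w.
Proof. revert p. induction w; intros; simpl; auto. Qed.

Lemma val_wend p w : word_over S w -> val (wend p w) = val p * eval w.
Proof.
  revert p. induction w as [|a w IH]; intros p Hw; simpl; [now rewrite gmul_one_r|].
  unfold wend in *. simpl. rewrite IH, val_act, gassoc; auto.
  - apply Hw. now left.
  - intros b Hb. apply Hw. now right.
Qed.

Lemma wend_winv p w : wend (wend p w) (winv w) = p.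
Proof.
  revert p. induction w as [|a w IH]; intros p; [reflexivity|].
  rewrite winv_cons, wend_app.
  change (wend p (a :: w)) with (wend (act p a) w). rewrite IH. apply act_inv.
Qed.

Definition wsum (g : elt * elt -> bool) (p : elt) (w : word G) : bool :=
  xsum g (edges p (wpath p w)).

Lemma wsum_app g p u v : wsum g p (u ++ v) = xorb (wsum g p u) (wsum g (wend p u) v).
Proof. unfold wsum. now rewrite wpath_app, edges_app, xsum_app. Qed.

Lemma wsum_winv g p w : cochain1 g -> wsum g (wend p w) (winv w) = wsum g p w.
Proof.
  intros Hg. revert p. induction w as [|a w IH]; intros p; [reflexivity|].
  rewrite winv_cons, wsum_app.
  change (wend p (a :: w)) with (wend (act p a) w). rewrite IH, wend_winv.
  unfold wsum. simpl. rewrite act_inv, (proj1 Hg (act p a) p).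
  now rewrite xorb_false_r, xorb_comm.
Qed.

Lemma wsum_cancel g p u a v :
  cochain1 g -> wsum g p (u ++ a :: inv_letter a :: v) = wsum g p (u ++ v).
Proof.
  intros Hg. rewrite !wsum_app. f_equal. unfold wsum. simpl.
  rewrite act_inv, (proj1 Hg (act _ a) _).
  now rewrite <- xorb_assoc, xorb_nilpotent, xorb_false_l.
Qed.

Lemma wend_cancel p u a v : wend p (u ++ a :: inv_letter a :: v) = wend p (u ++ v).
Proof. rewrite !wend_app. unfold wend. simpl. now rewrite act_inv. Qed.

Lemma path_word p l :
  Forall (close (fun p q => wdist S (val p) (val q)) 1%nat) (edges p l) ->
  exists w, word_over S w /\ wend p w = lst p l /\
    forall g, cochain1 g -> wsum g p w = xsum g (edges p l).
Proof.
  revert p. induction l as [|q l IH]; intros p Hl.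
  - exists []. split; [intros a []|]. split; reflexivity.
  - simpl in Hl. inversion Hl as [|? ? H1 H2]; subst. unfold close in H1. simpl in H1.
    destruct (IH q H2) as (w & W1 & W2 & W3).
    destruct (@subgroup_wdist_spec H S HH HS _ _ (val_in p) (val_in q)) as [(u & U1 & U2 & U3) _].
    destruct u as [|a [|b u]]; simpl in U2, U3; [| |lia].
    (* A step of length zero contributes no letter; its edge is degenerate, hence invisible to
       cochains. *)
    + assert (Epq : p = q).
      { apply val_inj, (gmul_cancel_l (/ val p)). now rewrite <- U3, ginv_mul. }
      subst q. exists w. split; [exact W1|]. split; [exact W2|].
      intros g Hg. simpl. rewrite (proj2 Hg p), xorb_false_l. auto.
    + assert (Ha : In (snd a) S) by (apply U1; now left).
      assert (Eq : act p a = q).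
      { apply val_inj. rewrite val_act by exact Ha.
        rewrite gmul_one_r in U3. now rewrite U3, gmul_inv_mul_l. }
      exists (a :: w). split; [intros c [<-|Hc]; auto|].
      unfold wend, wsum in *. simpl. rewrite Eq. split; [exact W2|].
      intros g Hg. f_equal. auto.
Qed.

Variables (Y : Type) (d : Y -> Y -> nat) (i : elt -> Y) (lam R : nat) (Rel : list (word G)).
Hypothesis M : geodesic_metric d.
Hypothesis Hlam : forall p a, d (i p) (i (act p a)) <= lam.
Hypothesis HlamR : lam <= R.
Hypothesis HRel : forall r, In r Rel -> word_over S r /\ eval r = 1.
Hypothesis HRelR : forall r, In r Rel -> (lam * length r <= R)%nat.

Let de := fun p q => d (i p) (i q).

Lemma wpath_close p w : Forall (close de lam) (edges p (wpath p w)).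
Proof. revert p. induction w; intros p; simpl; constructor; auto. apply Hlam. Qed.

Lemma short_loop_cone p w :
  (lam * length w <= R)%nat -> Forall (small de R) (cone p (edges p (wpath p w))).
Proof.
  intros Hw.
  assert (HD : forall v, In v (p :: wpath p w) -> de p v <= R).
  { intros v Hv. eapply Nat.le_trans; [|exact Hw].
    rewrite <- (length_wpath p w), <- (length_map i). unfold de.
    apply (path_dist M).
    - rewrite edges_map. apply Forall_map. apply wpath_close.
    - change (i p :: map i (wpath p w)) with (map i (p :: wpath p w)). now apply in_map. }
  apply cone_small.
  - eapply Forall_impl; [|apply wpath_close]. intros e. now apply close_mono.
  - intros e He. apply in_edges in He as [H1 H2]. split; apply HD; simpl; auto.
Qed.

(** The path of [u] is traversed out and back and cancels mod 2. This leaves the loop of [r] at the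
    end of [u], coned off from that point. *)
Lemma conjugate_filling u r p :
  (forall q, wend q r = q) -> (lam * length r <= R)%nat ->
  wend p (u ++ r ++ winv u) = p /\
  exists c, Forall (small de R) c /\ fills c (edges p (wpath p (u ++ r ++ winv u))).
Proof.
  intros Hr HR. split; [now rewrite !wend_app, Hr, wend_winv|].
  exists (cone (wend p u) (edges (wend p u) (wpath (wend p u) r))).
  split; [now apply short_loop_cone|].
  intros g Hg. change (xsum g (edges p _)) with (wsum g p (u ++ r ++ winv u)).
  rewrite !wsum_app, Hr, wsum_winv by exact Hg.
  rewrite (@cone_fills _ _ _ _ (Hr (wend p u)) g Hg).
  change (xsum g (edges (wend p u) _)) with (wsum g (wend p u) r).
  destruct (wsum g p u), (wsum g (wend p u) r); reflexivity.
Qed.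

Lemma relator_closed r q : In r Rel -> wend q r = q.
Proof.
  intros Hr. apply HRel in Hr as [H1 H2]. apply val_inj.
  now rewrite val_wend, H2, gmul_one_r.
Qed.

(** Conjugates of relators are coned off, and free reductions do not change the chain of a path. The
    triangles have diameter at most [R] in the metric pulled back from [Y]; their number is not
    controlled. *)
Lemma ncl_filling w :
  in_ncl Rel w -> forall p, wend p w = p /\
    exists c, Forall (small de R) c /\ fills c (edges p (wpath p w)).
Proof.
  induction 1 as [|u r Hr|u r Hr|w1 w2 _ IH1 _ IH2|w w' _ IH Hs|w w' _ IH Hs]; intros p.
  - split; [reflexivity|]. exists []. split; [constructor|]. now intros g _.
  - apply conjugate_filling; [|auto]. intros q. now apply relator_closed.
  - apply conjugate_filling; [|rewrite length_winv; auto].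
    intros q. rewrite <- (relator_closed r q Hr) at 1. apply wend_winv.
  - destruct (IH1 p) as (E1 & c1 & C1 & F1). destruct (IH2 p) as (E2 & c2 & C2 & F2).
    split; [now rewrite wend_app, E1|]. exists (c1 ++ c2).
    split; [apply Forall_app; auto|]. rewrite wpath_app, edges_app.
    fold (wend p w1). rewrite E1. now apply fills_app.
  - destruct (IH p) as (E & c & C & F). destruct Hs as [u v a].
    rewrite wend_cancel in E. split; [exact E|]. exists c. split; [exact C|].
    intros g Hg. rewrite (F g Hg). apply (wsum_cancel _ _ _ _ Hg).
  - destruct (IH p) as (E & c & C & F). destruct Hs as [u v a].
    rewrite wend_cancel. split; [exact E|]. exists c. split; [exact C|].
    intros g Hg. rewrite (F g Hg). symmetry. apply (wsum_cancel _ _ _ _ Hg).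
Qed.

End Presentation.
End WordMetric.

(** * Pushing fillings through a three-coloured cover *)

Definition prism {X} (tau : X -> X) (z : list (X * X)) : list (X * X * X) :=
  flat_map (fun e => [(fst e, snd e, tau (fst e)); (snd e, tau (fst e), tau (snd e))]) z.

Lemma length_prism {X} (tau : X -> X) z : length (prism tau z) = 2 * length z.
Proof. induction z; simpl; lia. Qed.

Lemma xsum_d1_prism {X} (tau : X -> X) g x l :
  cochain1 g ->
  xsum (d1 g) (prism tau (edges x l)) =
  xorb (xorb (xsum g (edges x l)) (xsum g (map (map_edge tau) (edges x l))))
       (xorb (g (x, tau x)) (g (lst x l, tau (lst x l)))).
Proof.
  intros [Hg _]. revert x. induction l as [|y l IH]; intros x.
  - simpl. now rewrite xorb_nilpotent.
  - change (prism tau (edges x (y :: l))) with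
      ([(x, y, tau x); (y, tau x, tau y)] ++ prism tau (edges y l)).
    rewrite xsum_app, IH. simpl. unfold map_edge. simpl.
    destruct (g (y, tau x)), (g (x, tau x)), (g (x, y)), (g (tau x, tau y)),
      (g (y, tau y)), (xsum g (edges y l)), (g (lst y l, tau (lst y l)));
      destruct (xsum g (map _ (edges y l))); reflexivity.
Qed.

(** Four vertices carry at most three colours, so two of them have the same image; then two faces
    degenerate and the other two coincide. *)
Lemma coloured_cocycle (X I : Type) (d : X -> X -> nat) R (phi : X -> I) (col : I -> nat) f :
  (forall i, col i <= 2) ->
  (forall x y, d x y <= R -> col (phi x) = col (phi y) -> phi x = phi y) ->
  cochain2 f -> cocycle2 d R (fun t => f (map_triangle phi t)).
Proof.
  intros Hcol Hphi (F1 & F2 & F3) a b c e ab ac ae bc be ce. simpl.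
  assert (F4 : forall a b, f (a, b, b) = false) by (intros; rewrite F1, F2; auto).
  assert (F5 : forall a b, f (a, b, a) = false) by (intros; rewrite F2; auto).
  assert (Hpig : phi a = phi b \/ phi a = phi c \/ phi a = phi e \/
                 phi b = phi c \/ phi b = phi e \/ phi c = phi e).
  { pose proof (Hcol (phi a)). pose proof (Hcol (phi b)).
    pose proof (Hcol (phi c)). pose proof (Hcol (phi e)).
    destruct (Nat.eq_dec (col (phi a)) (col (phi b))); [left; auto|].
    destruct (Nat.eq_dec (col (phi a)) (col (phi c))); [right; left; auto|].
    destruct (Nat.eq_dec (col (phi a)) (col (phi e))); [do 2 right; left; auto|].
    destruct (Nat.eq_dec (col (phi b)) (col (phi c))); [do 3 right; left; auto|].
    destruct (Nat.eq_dec (col (phi b)) (col (phi e))); [do 4 right; left; auto|].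
    do 5 right. apply Hphi; [exact ce|lia]. }
  destruct Hpig as [E|[E|[E|[E|[E|E]]]]]; rewrite E, ?F3, ?F4, ?F5.
  - now destruct (f (phi b, phi c, phi e)).
  - rewrite (F1 (phi c) (phi b) (phi e)). now destruct (f (phi b, phi c, phi e)).
  - rewrite (F1 (phi e) (phi b) (phi c)), (F2 (phi b) (phi e) (phi c)).
    now destruct (f (phi b, phi c, phi e)).
  - now destruct (f (phi a, phi c, phi e)).
  - rewrite (F2 (phi a) (phi c) (phi e)). now destruct (f (phi a, phi e, phi c)).
  - now destruct (f (phi a, phi b, phi e)).
Qed.

(* [cE] may be arbitrarily large, but its image in [I] equals that of [cX]
   because [I] carries no non-degenerate 3-simplices; after cancellation it is
   therefore no larger than [cX], and [psi] brings it back to [E]. *)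
Lemma push_filling (X E I : Type) (d : X -> X -> nat) (iota : E -> X)
    (phi : X -> I) (col : I -> nat) (psi : I -> E) delta R cE cX x l :
  geodesic_metric d -> hyperbolic_metric d delta -> 4 * delta + 2 <= R ->
  (forall i, col i <= 2) ->
  (forall x y, d x y <= R -> col (phi x) = col (phi y) -> phi x = phi y) ->
  Forall (small (fun p q => d (iota p) (iota q)) R) cE -> fills cE (edges x l) ->
  Forall (small d R) cX -> fills cX (edges (iota x) (map iota l)) ->
  let tau p := psi (phi (iota p)) in
  exists c, (forall t, In t c -> exists u, In u cE /\ t = map_triangle tau u) /\
    length c <= length cX /\ fills c (map (map_edge tau) (edges x l)).
Proof.
  intros M H4 HR Hcol Hphi SE FE SX FX tau.
  set (c1 := map (map_triangle (fun p => phi (iota p))) cE).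
  (* Together [cE] and [cX] form a 2-cycle in [X] at scale [R], on which every cocycle pulled back
     along [phi] vanishes. *)
  assert (Heq : forall f, cochain2 f -> xsum f c1 = xsum f (map (map_triangle phi) cX)).
  { intros f Hf.
    assert (H0 : xsum (fun t => f (map_triangle phi t)) (map (map_triangle iota) cE ++ cX) = false).
    { apply (@rips_two_cycle _ _ M delta R _ (iota x)); auto.
      - now apply map_triangle_cochain2.
      - now apply (@coloured_cocycle _ _ _ _ _ col).
      - apply Forall_app. split; [|exact SX]. apply Forall_map.
        eapply Forall_impl; [|exact SE]. now intros [[a b] e].
      - intros g Hg. rewrite xsum_app, (fills_map iota FE Hg), (FX g Hg), edges_map.
        apply xorb_nilpotent. }
    rewrite xsum_app, xsum_map in H0. unfold c1. rewrite !xsum_map.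
    rewrite (@xsum_ext _ (fun a => f (map_triangle (fun p => phi (iota p)) a))
      (fun a => f (map_triangle phi (map_triangle iota a)))) by now intros [[a b] e].
    now apply xorb_eq. }
  (* Reducing the image of [cE] rather than that of [cX] keeps every triangle an image from [E]; the
     length bound still comes from [cX], as both images are the same chain. *)
  destruct (reduced_representative (@same_triangle I) (@degenerate_triangle I) c1)
    as (L & Lin & Lred & Lf).
  exists (map (map_triangle psi) L). split; [|split].
  - intros t Ht. apply in_map_iff in Ht as (v & <- & Hv).
    apply Lin, in_map_iff in Hv as (u & <- & Hu). exists u. split; [exact Hu|].
    now destruct u as [[a b] e].
  - rewrite length_map, <- (length_map (map_triangle phi) cX).
    apply (@reduced_length _ (@same_triangle I) (@degenerate_triangle I)).
    + intros a b. apply Permutation_sym.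
    + intros a b e. apply Permutation_trans.
    + exact Lred.
    + intros t Ht. apply (@reduced_in _ _ (@degenerate_triangle I)) with (l := L); auto.
      * intros a. apply Permutation_refl.
      * intros a b. apply Permutation_sym.
      * intros a b e. apply Permutation_trans.
      * apply same_triangle_degenerate.
      * intros f Hf. rewrite (Lf f Hf). apply Heq. now apply admissible_cochain2.
  - intros g Hg. rewrite !xsum_map.
    rewrite (Lf _ (cochain2_admissible (map_triangle_cochain2 psi (d1_cochain2 Hg)))).
    unfold c1. rewrite xsum_map, <- (FE _ (map_edge_cochain1 tau Hg)).
    apply xsum_ext. now intros [[a b] e].
Qed.

(** * Linear fillings in the subgroup, and the conclusion *)

Section Main.
Variable G : Group.

Lemma four_point_metric H S delta :
  is_subgroup G H -> generates G H S ->
  four_point G H S delta <->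
  forall x y z w, H x -> H y -> H z -> H w ->
    let d := wdist G S in
    d x y + d z w <= Nat.max (d x z + d y w) (d y z + d x w) + 2 * delta.
Proof.
  intros HH HS. split.
  - intros H4 x y z w Hx Hy Hz Hw d.
    pose proof (H4 x y z w Hx Hy Hz Hw (d x y) (d x z) (d y z) (d x w) (d y w) (d z w)) as H0.
    assert (forall u v, H u -> H v -> is_dist G S u v (d u v))
      by (intros; apply subgroup_wdist_spec with (H := H); auto).
    specialize (H0 ltac:(auto) ltac:(auto) ltac:(auto) ltac:(auto) ltac:(auto) ltac:(auto)).
    lia.
  - intros H4 x y z w Hx Hy Hz Hw dxy dxz dyz dxw dyw dzw E1 E2 E3 E4 E5 E6.
    apply is_dist_wdist in E1, E2, E3, E4, E5, E6. subst.
    specialize (H4 x y z w Hx Hy Hz Hw). simpl in H4. lia.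
Qed.

Lemma subgroup_linear_filling H S Rel :
  hyperbolic G (full G) -> asdim_le G 2 -> is_subgroup G H -> generates G H S ->
  (forall r, In r Rel -> word_over S r /\ eval r = gone G) ->
  (forall w, word_over S w -> eval w = gone G -> in_ncl Rel w) ->
  exists K s, 1 <= s /\ forall x l, lst x l = x ->
    let d := fun p q : elt G H => wdist G S (val p) (val q) in
    Forall (close d 1) (edges x l) -> fillable d (K * length l) s (edges x l).
Proof.
  intros (S1 & HS1 & delta & H4) (S2 & HS2 & Has) HH HS HRel Hncl.
  pose proof (is_subgroup_full G) as Hfull.
  set (dG := wdist G S1).
  assert (M1 : geodesic_metric dG).
  { apply (@wdist_geodesic G (full G) S1 Hfull HS1 G (fun x => x)); unfold full; eauto. }
  assert (hyp : hyperbolic_metric dG delta).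
  { intros x y z w. pose proof (proj1 (@four_point_metric (full G) S1 delta Hfull HS1) H4).
    apply H0; exact I. }
  set (dH := fun p q : elt G H => wdist G S (val p) (val q)).
  assert (MH : geodesic_metric dH) by exact (elt_geodesic HH HS).
  assert (spec1 : forall x y, is_dist G S1 x y (dG x y)).
  { intros. now apply subgroup_wdist_spec with (H := full G). }
  assert (spec2 : forall x y, is_dist G S2 x y (wdist G S2 x y)).
  { intros. now apply subgroup_wdist_spec with (H := full G). }
  assert (quot : forall p q : elt G H, H (gmul G (ginv G (val p)) (val q))).
  { intros. apply HH; [apply HH|]; apply val_in. }
  destruct (@wdist_comparison G (full G) S S1 1 HS1) as [lam Hlam].
  (* Here [lam] bounds the [S1]-length of letters over [S]. The scale [R] accommodates the edges of
     loops in [H], the relator loops, and the scales of filling and contraction in [G]. *)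
  set (R := lam * (1 + list_sum (map (@length _) Rel)) + (8 * delta + 4)).
  destruct (@wdist_comparison G (full G) S1 S2 R HS2) as [N2 HN2].
  destruct (@wdist_comparison G H S1 S R HS) as [N1 HN1].
  (* Hyperbolicity and the cover come with generating sets [S1] and [S2]; separation beyond [N2] for
     [S2] forces separation beyond [R] for [S1]. *)
  destruct (Has N2) as (D & J & col & U & Ucov & Ucol & Udiam & Usep).
  destruct (@wdist_comparison G H S2 S D HS) as [rho Hrho].
  set (phi := fun x => proj1_sig (constructive_indefinite_description _ (Ucov x))).
  assert (Hphi : forall x, U (phi x) x).
  { intros x. exact (proj2_sig (constructive_indefinite_description _ (Ucov x))). }
  assert (phi_sep : forall x y, dG x y <= R -> col (phi x) = col (phi y) -> phi x = phi y).
  { intros x y Hxy Hc. apply NNPP. intros Hne.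
    pose proof (Usep _ _ Hne Hc x y _ (Hphi x) (Hphi y) (spec2 x y)).
    destruct (spec1 x y) as [(w & W1 & W2 & W3) _].
    pose proof (HN2 x y w I W1 W3 ltac:(lia)). lia. }
  set (one := exist H (gone G) (proj1 HH) : elt G H).
  (* A point of [H] assigned to the index [j]; the default [one] fills in where there is none. *)
  set (psi := fun j => epsilon (inhabits one) (fun p : elt G H => phi (val p) = j)).
  set (tau := fun p : elt G H => psi (phi (val p))).
  (* Both [p] and [tau p] lie in the same set of the cover, of diameter at most [D] in [G];
     finiteness of balls turns this into a bound in [H]. *)
  assert (Htau : forall p, dH p (tau p) <= rho).
  { intros p.
    assert (Ep : phi (val (tau p)) = phi (val p)).
    { unfold tau, psi. apply (epsilon_spec (inhabits one) (fun q => phi (val q) = phi (val p))). eauto. }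
    destruct (spec2 (val p) (val (tau p))) as [(w & W1 & W2 & W3) _].
    apply (Hrho _ _ w); auto. rewrite W2.
    apply (Udiam (phi (val p)) (val p) (val (tau p))); auto.
    rewrite <- Ep. apply Hphi. }
  assert (Hact : forall p a, dG (val p) (val (act HH HS p a)) <= lam).
  { intros p a. unfold act. destruct (excluded_middle_informative _) as [i|]; simpl.
    - apply (Hlam _ _ [a] I).
      + intros b [<-|[]]. exact i.
      + simpl. now rewrite gmul_mul_inv_l, gmul_one_r.
      + reflexivity.
    - rewrite (dist_refl M1). lia. }
  (* Per edge, the pushed filling has at most [(8 * delta + 4 + 1) * R] triangles and the prism two.
     Pushing by [tau] enlarges diameters from [N1] to at most [N1 + 2 * rho]; the extra one covers
     the unit edges in the prism. *)
  exists ((8 * delta + 4 + 1) * R + 2), (N1 + 2 * rho + 1). split; [lia|].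
  intros x l Hcl d Hl. subst d.
  destruct (path_word HH HS x l Hl) as (w & W1 & W2 & W3).
  assert (Ew : eval w = gone G).
  { apply (gmul_cancel_l G (val x)). rewrite <- (val_wend HH HS x W1), W2, Hcl.
    now rewrite gmul_one_r. }
  destruct (@ncl_filling G H S HH HS G dG (@val G H) lam R Rel M1 Hact)
    with (w := w) (p := x) as (_ & cE & SE & FE); auto.
  { unfold R. nia. }
  { intros r Hr. unfold R. enough (length r <= list_sum (map (@length _) Rel)) by nia.
    clear -Hr. induction Rel as [|r' L IH]; [destruct Hr|].
    simpl. destruct Hr as [->|Hr]; [lia|]. specialize (IH Hr). lia. }
  destruct (@coarse_loop_filling G dG M1 (8 * delta + 4) (8 * delta + 4) R)
    with (x := val x) (l := map (@val G H) l) as (cX & SX & LX & FX).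
  { unfold R. lia. }
  { unfold R. lia. }
  { intros. now apply hyperbolic_filling. }
  { now rewrite lst_map, Hcl. }
  { rewrite edges_map. apply Forall_map. eapply Forall_impl; [|exact Hl].
    intros [p q] Hpq. change (wdist G S (val p) (val q) <= 1) in Hpq. unfold close. simpl.
    destruct (@subgroup_wdist_spec G H S HH HS _ _ (val_in p) (val_in q))
      as [(u & U1 & U2 & U3) _].
    pose proof (Hlam (val p) (val q) u I U1 U3 ltac:(lia)). unfold R, dG. nia. }
  assert (FE' : fills cE (edges x l)).
  { intros g Hg. rewrite (FE g Hg). now apply W3. }
  destruct (@push_filling G (elt G H) J dG (@val G H) phi col psi delta R cE cX x l)
    as (c & C1 & C2 & C3); auto.
  { unfold R. lia. }
  fold tau in C1, C3.
  exists (c ++ prism tau (edges x l)). split; [|split].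
  - apply Forall_app. split; apply Forall_forall.
    + intros t Ht. destruct (C1 t Ht) as ([[a b] e] & Hu & ->).
      rewrite Forall_forall in SE. specialize (SE _ Hu). simpl in SE.
      assert (HE : forall p q : elt G H, dG (val p) (val q) <= R -> dH p q <= N1).
      { intros p q Hpq. destruct (spec1 (val p) (val q)) as [(u & U1 & U2 & U3) _].
        apply (HN1 _ _ u); auto. lia. }
      assert (HT : forall p q : elt G H, dG (val p) (val q) <= R ->
                dH (tau p) (tau q) <= N1 + 2 * rho + 1).
      { intros p q Hpq. specialize (HE p q Hpq).
        pose proof (Htau p). pose proof (Htau q).
        pose proof (dist_tri MH (tau p) p (tau q)). pose proof (dist_tri MH p q (tau q)).
        pose proof (dist_sym MH (tau p) p). lia. }
      simpl. fold (dH (tau a) (tau b)) (dH (tau b) (tau e)) (dH (tau a) (tau e)).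
      split; [|split]; apply HT; tauto.
    + intros t Ht. unfold prism in Ht. apply in_flat_map in Ht as ([p q] & Hpq & Ht).
      rewrite Forall_forall in Hl. specialize (Hl _ Hpq). unfold close in Hl. simpl in Hl.
      fold (dH p q) in Hl. simpl in Ht.
      pose proof (Htau p). pose proof (Htau q).
      pose proof (dist_sym MH p q). pose proof (dist_sym MH p (tau p)).
      pose proof (dist_tri MH q p (tau p)). pose proof (dist_tri MH (tau p) p (tau q)).
      pose proof (dist_tri MH p q (tau q)).
      destruct Ht as [<-|[<-|[]]]; simpl.
      * fold (dH p q) (dH q (tau p)) (dH p (tau p)). lia.
      * fold (dH q (tau p)) (dH (tau p) (tau q)) (dH q (tau q)). lia.
  - rewrite length_app, length_prism, length_edges. rewrite length_map in LX. lia.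
  - intros g Hg. rewrite xsum_app, (C3 g Hg), xsum_d1_prism, Hcl by exact Hg.
    destruct (xsum g (edges x l)), (xsum g (map (map_edge tau) (edges x l))),
      (g (x, tau x)); reflexivity.
Qed.

End Main.

Theorem theorem1p6 (G : Group) :
  hyperbolic G (full G) -> asdim_le G 2 ->
  forall H : gcar G -> Prop,
    is_subgroup G H -> fin_presented G H -> hyperbolic G H.
Proof.
  intros Hhyp Has H HH (S & Rel & HS & HRel & Hncl). exists S. split; [exact HS|].
  destruct (subgroup_linear_filling Hhyp Has HH HS HRel Hncl) as (K & s & Hs & Hfill).
  set (dH := fun p q : elt G H => wdist G S (val p) (val q)).
  assert (MH : geodesic_metric dH) by exact (elt_geodesic HH HS).
  destruct (@linear_filling_hyperbolic _ dH MH ((K + 1) * s) s Hs) as [delta Hd].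
  { apply (cycle_filling MH). apply (coarse_loop_filling MH) with (s0 := s); auto. }
  exists delta. apply (four_point_metric _ HH HS).
  intros x y z w Hx Hy Hz Hw.
  exact (Hd (exist H x Hx) (exist H y Hy) (exist H z Hz) (exist H w Hw)).
Qed.
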